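(* Suppose the data $(\mu^a,\psi^a)_{a\in A}$ (see context) satisfy: (1) $\psi_0^a(x)=x$ for all $x\in\mathbb{R}^d$, $a\in A$, and there is $C>0$ such that $\sup_{t>0}\sup_{a\in A}\frac{\|\psi_t^a(x)-x\|}{t}\le C(1+\|x\|)$ for all $x\in\mathbb{R}^d$; (2) there is $c\ge 0$ such that $\sup_{a\in A}\|\psi_t^a(x_1)-\psi_t^a(x_2)\|\le e^{ct}\|x_1-x_2\|$ for all $t\ge 0$ and $x_1,x_2\in\mathbb{R}^d$; (3) for every $\chi\in C_c^\infty(\mathbb{R}^d)$, $\limsup_{t\downarrow 0}\sup_{a\in A}\big|\int_{\mathbb{R}^d}\frac{\chi(y)-\chi(0)}{t}\,\mu_t^a(dy)\big|<\infty$; (4) $\mu_0^a=\delta_0$ for all $a\in A$, $\lim_{t\downarrow 0}\sup_{a\in A}\int_{\mathbb{R}^d}\|y\|^p\,\mu_t^a(dy)=0$, and for every $\varepsilon>0$ there is $M>0$ such that $\sup_{a\in A}\sup_{t>0}\frac{\mu_t^a(\{y:\|y\|>M\})}{t}<\varepsilon$. Let $\mathscr{L}^a$ be the infinitesimal generator of the reference semigroup $T^a$ ($a\in A$) and $\mathscr{L}$ the infinitesimal generator of the semigroup $\mathcal{S}$. Then, for every $f\in\bigcap_{a\in A}D(\mathscr{L}^a)\cap C_b^1$ with $$\sup_{a\in A}\|\mathscr{L}^af\|_\infty<\infty$$ and $$\lim_{t\downarrow0}\sup_{a\in A}\sup_{x\in K}\Big|\frac{(T^a(t)f)(x)-f(x)}{t}-(\mathscr{L}^af)(x)\Big|=0\quad\text{for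 all compact }K\subset\mathbb{R}^d,$$ it holds that $f\in D(\mathscr{L})$ and, for all $x\in\mathbb{R}^d$, $$(\mathscr{L}f)(x)=\inf_{a\in A}(\mathscr{L}^af)(x)+m\|\nabla f(x)\|.$$
   Context: Notation. $\|\cdot\|$ is the Euclidean norm on $\mathbb{R}^d$. $C_b$ is the space of bounded continuous functions $\mathbb{R}^d\to\mathbb{R}$, $\|f\|_\infty=\sup_x|f(x)|$, and $\|f\|_{\infty,K}=\sup_{x\in K}|f(x)|$ for compact $K\subset\mathbb{R}^d$. $C_b^1$ is the space of $f\in C_b$ that are continuously differentiable with bounded gradient. $C_b$ carries the mixed topology; a sequence $(f_n)\subset C_b$ converges to $f\in C_b$ in the mixed topology iff $\sup_n\|f_n\|_\infty<\infty$ and $\|f_n-f\|_{\infty,K}\to 0$ for every compact $K$. Limits as $t\downarrow0$ in the mixed topology mean convergence along every sequence $t_n\downarrow0$. Data. Fix $d\in\mathbb{N}$, $p\in(1,\infty)$, $m\ge 0$ and a nonempty set $A$. $\mathcal{P}_p$ is the set of Borel probability measures on $\mathbb{R}^d$ with finite $p$-th moment, and $\mathcal{W}_p$ is the $p$-Wasserstein distance on $\mathcal{P}_p$. For each $a\in A$, $\mu^a=(\mu_t^a)_{t\ge 0}\subset\mathcal{P}_p$ and $\psi^a=(\psi_t^a)_{t\ge0}$ is a family of continuous maps $\mathbb{R}^d\to\mathbb{R}^d$ such that the Chapman–Kolmogorov equations hold: $$\int f(\psi_{s+t}^a(x)+y)\,\mu_{s+t}^a(dy)=\int\int f\big(\psi_s^a(\psi_t^a(x)+y_t)+y_s\big)\,\mu_s^a(dy_s)\,\mu_t^a(dy_t)$$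 for all $s,t\ge 0$, $f\in C_b$, $x\in\mathbb{R}^d$. Operators. The reference semigroup is $(T^a(t)f)(x):=\int_{\mathbb{R}^d}f(\psi_t^a(x)+y)\,\mu_t^a(dy)$. Let $\mathcal{B}_t^a(m):=\{\nu\in\mathcal{P}_p:\mathcal{W}_p(\mu_t^a,\nu)\le tm\}$, and for $t\ge 0$, $f\in C_b$, $x\in\mathbb{R}^d$, $$(I(t)f)(x):=\inf_{a\in A}\sup_{\nu\in\mathcal{B}_t^a(m)}\int_{\mathbb{R}^d}f(\psi_t^a(x)+z)\,\nu(dz).$$ Under hypotheses (1)–(4) of the claim, $I(t)$ maps $C_b$ to $C_b$. $\mathrm{P}_t$ ($t\ge0$) is the set of all finite subsets $\pi\subset[0,\infty)$ with $0\in\pi$ and $\max\pi=t$. For $\pi=\{t_0,\dots,t_k\}$ with $0=t_0<\dots<t_k$, $k\ge1$, $\mathcal{I}(\pi)f:=I(t_1-t_0)\cdots I(t_k-t_{k-1})f$ (composition), and $\mathcal{I}(\{0\})f:=f$. Define $(\mathcal{S}(t)f)(x):=\inf_{\pi\in\mathrm{P}_t}(\mathcal{I}(\pi)f)(x)$. Strongly continuous monotone semigroups. A family $S=(S(t))_{t\ge0}$ of (sequentially, in the mixed topology) continuous operators $C_b\to C_b$ is a strongly continuous monotone semigroup if $S(0)f=f$; $f\le g$ implies $S(t)f\le S(t)g$; $S(t)S(s)=S(t+s)$; and $t\mapsto S(t)f$ is continuous in the mixed topology for every $f\in C_b$. Under hypotheses (1)–(4), $\mathcal{S}$ and each $T^a$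 are strongly continuous monotone semigroups on $C_b$. Generators. The infinitesimal generator $L:D(L)\subset C_b\to C_b$ of a strongly continuous monotone semigroup $S$ is $Lf:=\lim_{t\downarrow0}\frac{S(t)f-f}{t}$, where $D(L)$ is the set of $f\in C_b$ for which this limit exists in $C_b$ with respect to the mixed topology. $\mathscr{L}^a$ is the generator of $T^a$, and $\mathscr{L}$ is the generator of $\mathcal{S}$. *)

(* Defs.v *)
From mathcomp Require Import all_boot all_order all_algebra.
From mathcomp Require Import all_classical all_reals all_analysis.

Set Implicit Arguments.
Unset Strict Implicit.
Unset Printing Implicit Defensive.

Import Order.TTheory GRing.Theory Num.Theory.
Import numFieldNormedType.Exports.

Local Open Scope classical_set_scope.
Local Open Scope ring_scope.

(* The library norm of 'rV[R]_d is the sup norm, hence the Euclidean norm is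
   defined here; both norms induce the topology of 'rV[R]_d. *)
Definition enorm {R : realType} {d : nat} (x : 'rV[R]_d) : R :=
  Num.sqrt (\sum_(i < d) x 0 i ^+ 2).

(* R^d with its Borel sigma-algebra *)
Notation borelRd R d := (g_sigma_algebraType (@open 'rV[R]_d)).

Section spaces.
Context {R : realType} {d : nat}.
Local Notation Rd := ('rV[R]_d).

(* Supremum in [0, +oo], so that it is 0 (and not -oo) when K is empty *)
Definition sup_norm (K : set Rd) (f : Rd -> R) : \bar R :=
  ereal_sup (0%:E |` [set `|f x|%:E | x in K]).

Definition Cb : set (Rd -> R) :=
  [set f | continuous f /\ (sup_norm setT f < +oo)%E].

Definition partial (i : 'I_d) (f : Rd -> R) : Rd -> R :=
  fun x => 'D_(delta_mx 0 i) f x.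

Definition grad (f : Rd -> R) (x : Rd) : Rd := \row_(i < d) partial i f x.

Definition Cb1 : set (Rd -> R) :=
  [set f | Cb f /\ (forall x, differentiable f x) /\
           continuous (grad f) /\ exists M : R, forall x, enorm (grad f x) <= M].

(* Every iterated partial derivative exists and is differentiable. *)
Definition smooth (f : Rd -> R) : Prop :=
  forall (s : seq 'I_d) (x : Rd), differentiable (foldr partial f s) x.

Definition Ccinfty : set (Rd -> R) :=
  [set f | smooth f /\ compact (closure [set x | f x != 0])].

(* Sequential convergence in the mixed topology of C_b *)
Definition mixed_cvg (f_ : nat -> Rd -> R) (f : Rd -> R) : Prop :=
  [/\ forall n, Cb (f_ n), Cb f,
      (ereal_sup (range (fun n => sup_norm setT (f_ n))) < +oo)%E &
      forall K : set Rd, compact K ->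
        (fun n => sup_norm K (fun x => f_ n x - f x)) @ \oo --> 0%E].

End spaces.

Section generator.
Context {R : realType} {d : nat}.
Local Notation Rd := ('rV[R]_d).
Implicit Types (S : R -> (Rd -> R) -> Rd -> R) (f g : Rd -> R).

Definition generator_lim S f g : Prop :=
  forall t_ : nat -> R, (forall n, 0 < t_ n) -> t_ @ \oo --> (0 : R) ->
    mixed_cvg (fun n x => (S (t_ n) f x - f x) / t_ n) g.

Definition generator_dom S : set (Rd -> R) :=
  [set f | Cb f /\ exists g, generator_lim S f g].

(* The limit is unique; the value off generator_dom S is irrelevant. *)
Definition generator S f : Rd -> R :=
  xget (fun=> 0) [set g | generator_lim S f g].

End generator.

Section wasserstein.
Context {R : realType} {d : nat}.
Local Notation Rd := ('rV[R]_d).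
Local Notation E := (borelRd R d).

Definition finite_moment (p : R) (mu : probability E R) : Prop :=
  (\int[mu]_y (enorm (y : Rd) `^ p)%:E < +oo)%E.

(* R^d x R^d carries the product sigma-algebra, which is its Borel one. *)
Definition coupling (mu nu : probability E R) : set (probability (E * E)%type R) :=
  [set pi | forall U : set E, measurable U ->
     pi (fst @^-1` U) = mu U /\ pi (snd @^-1` U) = nu U].

Definition wasserstein (p : R) (mu nu : probability E R) : \bar R :=
  (ereal_inf [set \int[pi]_z (enorm ((z.1 : Rd) - (z.2 : Rd)) `^ p)%:E
             | pi in coupling mu nu] `^ p^-1)%E.

End wasserstein.

Section operators.
Context {R : realType} {d : nat} {A : Type}.
Local Notation Rd := ('rV[R]_d).
Local Notation E := (borelRd R d).
Variables (p m : R) (mu : A -> R -> probability E R) (psi : A -> R -> Rd -> Rd).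

Definition ref_semigroup (a : A) (t : R) (f : Rd -> R) (x : Rd) : R :=
  \int[mu a t]_y f (psi a t x + (y : Rd)).

Definition wball (a : A) (t : R) : set (probability E R) :=
  [set nu | finite_moment p nu /\
            (wasserstein p (mu a t) nu <= (t * m)%:E)%E].

(* For f in C_b and 0 <= t these are suprema and infima of nonempty bounded
   sets of reals, mu a t being a point of its own ball. *)
Definition I_op (t : R) (f : Rd -> R) (x : Rd) : R :=
  inf (range (fun a =>
    sup [set \int[nu]_z f (psi a t x + (z : Rd)) | nu in wball a t])).

(* The finite set {0 < t_1 < ... < t_k} with maximum t is represented by the
   increasing sequence t_1, ..., t_k; the point 0 is left implicit. *)
Definition partitions (t : R) : set (seq R) :=
  [set s | path <%R 0 s /\ last 0 s = t].

Fixpoint I_chain (u : R) (s : seq R) (f : Rd -> R) : Rd -> R :=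
  if s is v :: s' then I_op (v - u) (I_chain v s' f) else f.

Definition S_op (t : R) (f : Rd -> R) (x : Rd) : R :=
  inf [set I_chain 0 s f x | s in partitions t].

End operators.

(* Main.v *)
Require Import Defs.
From HB Require Import structures.
From mathcomp Require Import all_boot all_order all_algebra.
From mathcomp Require Import all_classical all_reals all_analysis.
From mathcomp Require Import measurable_realfun ring lra.

Set Implicit Arguments.
Unset Strict Implicit.
Unset Printing Implicit Defensive.

Import Order.TTheory GRing.Theory Num.Theory.
Import numFieldNormedType.Exports.

Local Open Scope classical_set_scope.
Local Open Scope ring_scope.

(** Why the theorem holds.  Write [L^a] for the generator of [T^a], [C0] for a
    common bound of the functions [L^a f], and
    [g x = inf_a (L^a f) x + m |grad f x|].

    One step.  A measure [nu] of the Wasserstein ball around [mu_h^a] is joined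
    to [mu_h^a] by a coupling of cost about [(h m)^p].  As [p > 1], a
    displacement of mean size [h m] is rarely large, so it changes the mean of
    [f] by at most [h m |grad f x| + o(h)] ([upper_expansion]); translating
    [mu_h^a] by a vector of length [h m] in the direction of the gradient
    attains this bound ([lower_expansion]).  Both hold uniformly in [a] and
    locally uniformly in [x], and [T^a(h) f = f + h L^a f + o(h)] by
    assumption.  Hence [I(h) f = f + h g + o(h)] locally uniformly.

    Upper bound.  [S(t) f <= I(t) f], since [{0, t}] is a partition ([S_upper]).

    Lower bound.  Every partition must be handled at once, and the expansion of
    [I(h) f] is only local, while far away [I(h) f >= f - C0 h] is all that is
    known.  The truncated square [z = min (|y - x0|^2, de^2)] vanishes at [x0]
    and equals [de^2] away from it, so with [ka] close to [g x0] and [B] large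
    one has [I(h) f >= f + h (ka - B z)] everywhere.  Composing such bounds along
    a partition requires that the mean of [z] under any admissible transition of
    duration [h] exceed [z] by at most [K h]: this is [cap_step], and it is
    where the hypothesis on smooth test functions enters.  Induction along the
    partition ([I_chain_lower]) then gives
    [f + t (ka - B z) - B K t^2], that is [f + t g - o(t)] at [x0] ([S_lower]).

    Test functions.  [z] is an infimum of quadratic functions, so its increments
    are bounded above by a linear term plus a square ([cap_expand]).  After
    localisation by one explicit bump, only the test functions [bump] and
    [y_i bump] occur, whatever the base point.

    Uniform bounds.  Mixed convergence also asks for difference quotients that
    are bounded on the whole space.  They follow from
    [|T^a(t) f - f| <= C0 t] for all small [t] ([ref_semigroup_bound]), obtained
    by telescoping over many small steps.  Finally [f] is Lipschitz because its
    gradient is bounded, and all the operators preserve bounded Lipschitz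
    functions, which gives the continuity of [S(t) f]. *)

(** * Euclidean geometry of row vectors *)

Section euclidean.
Context {R : realType} {d : nat}.
Local Notation Rd := ('rV[R]_d).
Implicit Types x y v : Rd.

Definition dot x y : R := \sum_(i < d) x 0 i * y 0 i.

Lemma sqsum_ge0 x : 0 <= \sum_(i < d) x 0 i ^+ 2.
Proof. by apply: sumr_ge0 => i _; rewrite sqr_ge0. Qed.

Lemma enorm_ge0 x : 0 <= enorm x.
Proof. exact: sqrtr_ge0. Qed.

Lemma enorm_sqr x : enorm x ^+ 2 = \sum_(i < d) x 0 i ^+ 2.
Proof. by rewrite sqr_sqrtr ?sqsum_ge0. Qed.

Lemma dotxx x : dot x x = enorm x ^+ 2.
Proof. by rewrite enorm_sqr; apply: eq_bigr => i _; rewrite expr2. Qed.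

Lemma enorm0 : enorm (0 : Rd) = 0.
Proof.
by rewrite /enorm big1 ?sqrtr0// => i _; rewrite mxE expr0n.
Qed.

Lemma enormN x : enorm (- x) = enorm x.
Proof. by congr Num.sqrt; apply: eq_bigr => i _; rewrite mxE sqrrN. Qed.

Lemma enorm_distC x y : enorm (x - y) = enorm (y - x).
Proof. by rewrite -enormN opprB. Qed.

Lemma enormZ (k : R) x : enorm (k *: x) = `|k| * enorm x.
Proof.
rewrite /enorm -sqrtr_sqr -sqrtrM ?sqr_ge0// mulr_sumr.
by congr Num.sqrt; apply: eq_bigr => i _; rewrite mxE exprMn.
Qed.

Lemma coord_le_enorm x (i : 'I_d) : `|x 0 i| <= enorm x.
Proof.
rewrite -sqrtr_sqr ler_wsqrtr// (bigD1 i)//= lerDl.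
by apply: sumr_ge0 => j _; rewrite sqr_ge0.
Qed.

Lemma enorm_eq0 x : enorm x = 0 -> x = 0.
Proof.
move=> x0; apply/rowP => i; rewrite mxE; apply/eqP; rewrite -normr_le0.
by rewrite -x0 coord_le_enorm.
Qed.

(** Summing the inequalities 2 s t <= s^2 + t^2 for the coordinates of the
    normalised vectors. *)
Lemma dot_le x y : dot x y <= enorm x * enorm y.
Proof.
have [x0|xn0] := eqVneq (enorm x) 0.
  by rewrite /dot big1 ?x0 ?mul0r// => i _; rewrite (enorm_eq0 x0) mxE mul0r.
have [y0|yn0] := eqVneq (enorm y) 0.
  by rewrite /dot big1 ?y0 ?mulr0// => i _; rewrite (enorm_eq0 y0) mxE mulr0.
have xp : 0 < enorm x by rewrite lt_neqAle eq_sym xn0 enorm_ge0.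
have yp : 0 < enorm y by rewrite lt_neqAle eq_sym yn0 enorm_ge0.
have xyp : 0 < enorm x * enorm y by rewrite mulr_gt0.
have : \sum_(i < d) (2 * (enorm x * enorm y) * (x 0 i * y 0 i)) <=
    \sum_(i < d) (enorm y ^+ 2 * x 0 i ^+ 2 + enorm x ^+ 2 * y 0 i ^+ 2).
  apply: ler_sum => i _; rewrite -subr_ge0.
  have -> : enorm y ^+ 2 * x 0 i ^+ 2 + enorm x ^+ 2 * y 0 i ^+ 2
    - 2 * (enorm x * enorm y) * (x 0 i * y 0 i) =
    (enorm y * x 0 i - enorm x * y 0 i) ^+ 2 by ring.
  exact: sqr_ge0.
rewrite -mulr_sumr big_split/= -!mulr_sumr -!enorm_sqr.
have -> : enorm y ^+ 2 * enorm x ^+ 2 + enorm x ^+ 2 * enorm y ^+ 2 =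
  2 * (enorm x * enorm y) * (enorm x * enorm y) by ring.
by rewrite ler_pM2l// mulr_gt0.
Qed.

Lemma normr_dot_le x y : `|dot x y| <= enorm x * enorm y.
Proof.
rewrite ler_norml dot_le andbT lerNl -(enormN x); apply: le_trans (dot_le _ _).
by rewrite /dot -sumrN; apply: ler_sum => i _; rewrite mxE mulNr.
Qed.

Lemma enormD x y : enorm (x + y) <= enorm x + enorm y.
Proof.
rewrite -(ler_pXn2r (ltn0Sn 1)) ?nnegrE ?enorm_ge0 ?addr_ge0 ?enorm_ge0//.
have -> : enorm (x + y) ^+ 2 = enorm x ^+ 2 + 2 * dot x y + enorm y ^+ 2.
  rewrite !enorm_sqr /dot mulr_sumr -!big_split/=.
  by apply: eq_bigr => i _; rewrite mxE; ring.
by have := dot_le x y; nra.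
Qed.

Lemma enormB x y : enorm (x - y) <= enorm x + enorm y.
Proof. by rewrite -(enormN y) enormD. Qed.

Lemma enorm_le_dist x y : enorm x <= enorm y + enorm (x - y).
Proof. by rewrite {1}(_ : x = y + (x - y)) ?enormD// addrC subrK. Qed.

Lemma dotDl x y v : dot (x + y) v = dot x v + dot y v.
Proof. by rewrite -big_split; apply: eq_bigr => i _; rewrite mxE mulrDl. Qed.

Lemma dotZl (k : R) x v : dot (k *: x) v = k * dot x v.
Proof. by rewrite mulr_sumr; apply: eq_bigr => i _; rewrite mxE mulrA. Qed.

Lemma dotC x y : dot x y = dot y x.
Proof. by apply: eq_bigr => i _; rewrite mulrC. Qed.

Lemma dotDr x y v : dot v (x + y) = dot v x + dot v y.
Proof. by rewrite dotC dotDl ![dot v _]dotC. Qed.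

Lemma dotZr (k : R) x v : dot v (k *: x) = k * dot v x.
Proof. by rewrite dotC dotZl dotC. Qed.

Lemma normr_le_enorm x : `|x| <= enorm x.
Proof.
have -> : `|x| = mx_norm x by [].
rewrite mx_normrE; apply: bigmax_le => [|[i j] _ /=]; first exact: enorm_ge0.
by rewrite (ord1 i); apply: coord_le_enorm.
Qed.

Lemma enorm_le_normr x : enorm x <= d.+1%:R * `|x|.
Proof.
have c i : `|x 0 i| <= `|x|.
  have -> : `|x| = mx_norm x by [].
  by rewrite mx_normrE; apply: (le_bigmax _ (fun j => `|x j.1 j.2|) (0, i)).
rewrite -(ger0_norm (mulr_ge0 (ler0n R _) (normr_ge0 x))) -sqrtr_sqr.
rewrite ler_wsqrtr//; apply: (@le_trans _ _ (\sum_(i < d) `|x| ^+ 2)).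
  apply: ler_sum => i _; rewrite -[x 0 i ^+ 2]ger0_norm ?sqr_ge0// normrX.
  by rewrite lerXn2r// nnegrE.
rewrite sumr_const card_ord exprMn -[leLHS]mulr_natl ler_wpM2r ?sqr_ge0//.
by rewrite -natrX ler_nat (leq_trans (leqnSn d))// expnS expn1 leq_pmulr.
Qed.

Lemma near_enorm (x : Rd) (e : R) : 0 < e -> \forall y \near x, enorm (y - x) <= e.
Proof.
move=> e0; near=> y; apply: (le_trans (enorm_le_normr _)).
rewrite mulrC -ler_pdivlMr// distrC; near: y.
apply: (@cvgr_dist_le _ _ _ (nbhs x) _ id x) => //.
by rewrite divr_gt0.
Unshelve. all: by end_near. Qed.

Lemma near_enormP (x : Rd) (P : set Rd) : (\forall y \near x, P y) ->
  exists2 e, 0 < e & forall y, enorm (y - x) <= e -> P y.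
Proof.
move=> /nbhs_ballP [e /= e0 He]; exists (e / 2); first by rewrite divr_gt0.
move=> y yx; apply: He; rewrite -ball_normE /ball_/= distrC.
rewrite (le_lt_trans (normr_le_enorm _))// (le_lt_trans yx)//.
by rewrite ltr_pdivrMr// ltr_pMr// ltr1n.
Qed.

Lemma enorm_le_cvg (f : Rd -> R) (x : Rd) :
  (forall e, 0 < e -> exists2 de, 0 < de &
     forall y, enorm (y - x) <= de -> `|f y - f x| <= e) ->
  {for x, continuous f}.
Proof.
move=> H; apply/(@cvgrPdist_le _ _ _ (nbhs x)) => e e0; have [de de0 Hd] := H _ e0.
by apply: filterS (near_enorm x de0) => y /Hd; rewrite distrC.
Qed.

Lemma continuous_enorm : continuous (@enorm R d).
Proof.
move=> x; apply: enorm_le_cvg => e e0; exists e => // y yx.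
rewrite ler_norml; have := enorm_le_dist x y; have := enorm_le_dist y x.
by rewrite (enorm_distC x y); lra.
Qed.

Lemma compact_enorm_ball (r : R) : compact [set x : Rd | enorm x <= r].
Proof.
apply: bounded_closed_compact.
  exists r; split; first exact: num_real.
  move=> M rM x /= xr.
  by rewrite (le_trans (normr_le_enorm x))// (le_trans xr)// ltW.
rewrite (_ : [set x | _] = @enorm R d @^-1` [set t | t <= r])//.
by apply: closed_comp => [x _|]; [exact: continuous_enorm|exact: closed_le].
Qed.

Lemma compact_enorm_bounded (K : set Rd) :
  compact K -> exists2 r, 0 < r & forall x, K x -> enorm x <= r.
Proof.
move=> /compact_bounded [M [_ HM]].
exists (d.+1%:R * (`|M| + 1)); first by rewrite mulr_gt0// ltr_wpDl.
move=> x Kx; apply: (le_trans (enorm_le_normr x)); rewrite ler_pM2l//.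
by apply: (HM (`|M| + 1)) => //; rewrite (le_lt_trans (ler_norm M))// ltrDl.
Qed.

End euclidean.

Section lipschitz.
Context {R : realType} {d : nat}.
Local Notation Rd := ('rV[R]_d).

Definition elip (L : R) (f : Rd -> R) :=
  forall x y, `|f x - f y| <= L * enorm (x - y).

Lemma elip_of_le L (f : Rd -> R) :
  (forall x y, f x <= f y + L * enorm (x - y)) -> elip L f.
Proof.
by move=> H x y; rewrite ler_distl H andbT lerBlDr (enorm_distC x y) H.
Qed.

Lemma elip_continuous L f : elip L f -> continuous f.
Proof.
move=> fL x; apply: enorm_le_cvg => e e0; exists (e / (`|L| + 1)).
  by rewrite divr_gt0// ltr_wpDl.
move=> y yx; apply: (le_trans (fL _ _)).
apply: (@le_trans _ _ ((`|L| + 1) * enorm (y - x))).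
  rewrite ler_wpM2r ?enorm_ge0// (le_trans (ler_norm L))// lerDl//.
by rewrite mulrC -ler_pdivlMr// ltr_wpDl.
Qed.

(** The set of moduli that work near a given point is a neighbourhood of [0] on
    the right; compactness of the ball makes one modulus work everywhere. *)
Lemma unif_continuous_ball (g : Rd -> Rd) (r e : R) :
  continuous g -> 0 < e -> exists2 de, 0 < de &
  forall x y, enorm x <= r -> enorm (y - x) <= de -> enorm (g y - g x) <= e.
Proof.
move=> gc e0; have /compact_near_coveringP cov := @compact_enorm_ball R d r.
pose P de x := forall y, enorm (y - x) <= de -> enorm (g y - g x) <= e.
have : \forall de \near 0^'+, [set x : Rd | enorm x <= r] `<=` P de.
  apply: cov => x _.
  have /near_enormP [eta eta0 Heta] :
      \forall y \near x, enorm (g y - g x) <= e / 2.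
    by have := gc x _ (near_enorm (g x) (divr_gt0 e0 (ltr0Sn R 1))).
  exists ([set y : Rd | enorm (y - x) <= eta / 2],
          [set de : R | de <= eta / 2]).
    split; first by apply: near_enorm; rewrite divr_gt0.
    by apply: nbhs_right_le; rewrite divr_gt0.
  move=> [x' de] /= [x'x dele] y yx'.
  have h1 : enorm (g y - g x) <= e / 2.
    apply: Heta; rewrite -(subrKA x'); apply: (le_trans (enormD _ _)).
    by lra.
  have h2 : enorm (g x' - g x) <= e / 2.
    by apply: Heta; lra.
  rewrite -(subrKA (g x)); apply: (le_trans (enormD _ _)).
  by rewrite (enorm_distC (g x)); lra.
move=> [de /= de0 Hde]; exists (de / 2); first by rewrite divr_gt0.
move=> x y xr; apply: (Hde (de / 2)) => //=; last by rewrite divr_gt0.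
by rewrite sub0r normrN ger0_norm; lra.
Qed.

End lipschitz.

(** * Gradients and the mean value theorem *)

Section gradient.
Context {R : realType} {d : nat}.
Local Notation Rd := ('rV[R]_d).
Implicit Types (f : Rd -> R) (x v : Rd).

Lemma derive_grad f x v : differentiable f x -> 'D_v f x = dot (grad f x) v.
Proof.
move=> df; rewrite deriveE// {1}(row_sum_delta v) linear_sum.
apply: eq_bigr => i _; rewrite linearZ/= mxE /partial deriveE// mulrC//.
Qed.

Lemma is_derive_line f x v (t : R) : differentiable f (x + t *: v) ->
  is_derive t 1 (fun s => f (x + s *: v)) (dot (grad f (x + t *: v)) v).
Proof.
move=> df.
have dg : differentiable (fun s : R => x + s *: v) t by [].
have dfg : differentiable (f \o (fun s : R => x + s *: v)) t.
  exact: differentiable_comp.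
apply: DeriveDef; first exact/derivable1_diffP.
rewrite deriveE// diff_comp//= -derive_grad// deriveE//; congr ('d f _ _).
have D : is_diff t (cst x + ( *:%R ^~ v) : R -> Rd) (0 + ( *:%R ^~ v)).
  exact: is_diffD.
have := congr1 (fun h : R -> Rd => h 1) (diff_val (is_diff_def := D)).
by rewrite /= => ->; rewrite /GRing.add/= add0r scale1r.
Qed.

Lemma mean_value f x v : (forall y, differentiable f y) ->
  exists2 c, 0 <= c <= 1 & f (x + v) - f x = dot (grad f (x + c *: v)) v.
Proof.
move=> df.
have c01 : {within `[0, 1], continuous (fun s : R => f (x + s *: v))}.
  apply: continuous_subspaceT => t; apply: differentiable_continuous.
  by apply/derivable1_diffP; have [] := is_derive_line (df (x + t *: v)).
have [c cI] := @MVT_segment R _ (fun t => dot (grad f (x + t *: v)) v) 0 1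
  ler01 (fun t _ => is_derive_line (df (x + t *: v))) c01.
rewrite scale1r scale0r addr0 subr0 mulr1 => fE.
by exists c => //; move: cI; rewrite in_itv.
Qed.

Lemma elip_of_grad f (L : R) : (forall y, differentiable f y) ->
  (forall y, enorm (grad f y) <= L) -> elip L f.
Proof.
move=> df fL x y; have [c _] := mean_value y (x - y) df.
rewrite (addrC y) subrK => ->; apply: (le_trans (normr_dot_le _ _)).
by rewrite ler_wpM2r ?enorm_ge0.
Qed.

End gradient.

(** * Borel measurability *)

Section borel.
Context {R : realType} {d : nat}.
Local Notation Rd := ('rV[R]_d).
Local Notation E := (borelRd R d).

Lemma continuous_borel_measurable (f : Rd -> R) : continuous f ->
  measurable_fun setT (f : E -> R).
Proof.
move=> /continuousP cf; apply: (measurability _ (RGenOpens.measurableE R)).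
move=> _ [_ [a [b ->] <-]]; rewrite setTI; apply: sub_sigma_algebra.
exact/cf/interval_open.
Qed.

Lemma continuous_borel_measurableRd (f : Rd -> Rd) : continuous f ->
  measurable_fun setT (f : E -> E).
Proof.
move=> /continuousP cf; apply: (@measurability _ _ E E setT f (@open Rd)) => //.
by move=> _ [U oU <-]; rewrite setTI; apply: sub_sigma_algebra; exact: cf.
Qed.

Lemma measurable_dist_enorm :
  measurable_fun setT (fun z : E * E => enorm ((z.1 : Rd) - (z.2 : Rd))).
Proof.
have mc (i : 'I_d) : measurable_fun setT (fun y : E => (y : Rd) 0 i).
  by apply: continuous_borel_measurable; exact: coord_continuous.
apply: (@measurableT_comp _ _ _ _ _ _ (@Num.sqrt R)) => //=.
  by apply: continuous_measurable_fun; exact: sqrt_continuous.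
apply: measurable_sum => i; apply: measurable_funX.
rewrite (_ : (fun z : E * E => _) =
    (fun z : E * E => (z.1 : Rd) 0 i - (z.2 : Rd) 0 i)); last first.
  by apply/funext => z; rewrite !mxE.
apply: measurable_funB; first exact: (measurableT_comp (mc i) measurable_fst).
exact: (measurableT_comp (mc i) measurable_snd).
Qed.

End borel.

(** * Couplings and Wasserstein balls *)

Section prob_integral.
Context {dd : measure_display} {T : measurableType dd} {R : realType}
        (P : probability T R).
Implicit Types f g : T -> R.

Lemma bounded_integrable f (M : R) :
  measurable_fun setT f -> (forall x, `|f x| <= M) -> P.-integrable setT (EFin \o f).
Proof.
move=> mf fM; apply: measurable_bounded_integrable => //.
  by apply: (@le_lt_trans _ _ 1%E); [exact: probability_le1|exact: ltry].
exists M; split; first exact: num_real.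
by move=> x Mx y _ /=; apply: (le_trans (fM y)); exact: ltW.
Qed.

Lemma prob_Rintegral_cst (c : R) : \int[P]_x c = c.
Proof.
rewrite Rintegral_cst// (_ : fine _ = 1) ?mulr1//.
exact: (congr1 fine (@probability_setT _ _ _ P)).
Qed.

Lemma integrable_cst (c : R) : P.-integrable setT (EFin \o (fun=> c)).
Proof. exact: (@bounded_integrable _ `|c|). Qed.

Lemma integrable_affine f g (a b c : R) :
  P.-integrable setT (EFin \o f) -> P.-integrable setT (EFin \o g) ->
  P.-integrable setT (EFin \o (fun x => a * f x + b * g x + c)).
Proof.
move=> If Ig; have := integrableD measurableT (integrableD measurableT
  (integrableZl measurableT a If) (integrableZl measurableT b Ig)) (integrable_cst c).
by [].
Qed.

Lemma Rintegral_affine f g (a b c : R) :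
  P.-integrable setT (EFin \o f) -> P.-integrable setT (EFin \o g) ->
  \int[P]_x (a * f x + b * g x + c) = a * \int[P]_x f x + b * \int[P]_x g x + c.
Proof.
move=> If Ig.
have IZ h k : P.-integrable setT (EFin \o h) ->
    P.-integrable setT (EFin \o (fun x => k * h x)).
  by move=> Ih; have := integrableZl measurableT k Ih.
have ID : P.-integrable setT (EFin \o (fun x => a * f x + b * g x)).
  by have := integrableD measurableT (IZ _ a If) (IZ _ b Ig).
rewrite RintegralD//; last exact: integrable_cst.
rewrite RintegralD//; [|exact: IZ|exact: IZ].
by rewrite prob_Rintegral_cst !RintegralZl.
Qed.

End prob_integral.

Lemma image_measure_integral {d1 d2 : measure_display} {T1 : measurableType d1}
    {T2 : measurableType d2} {R : realType}
    (m1 : {measure set T1 -> \bar R}) (m2 : {measure set T2 -> \bar R})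
    (phi : T1 -> T2) (u : T2 -> R) :
  measurable_fun setT phi -> measurable_fun setT u ->
  (forall U, measurable U -> m1 (phi @^-1` U) = m2 U) ->
  m2.-integrable setT (EFin \o u) ->
  m1.-integrable setT (EFin \o (u \o phi)) /\
  \int[m1]_x u (phi x) = \int[m2]_y u y.
Proof.
move=> mphi mu m12 Iu.
have m21 (g : T2 -> \bar R) : (\int[m2]_y g y = \int[pushforward m1 phi]_y g y)%E.
  by apply: eq_measure_integral => U mU _; rewrite /= /pushforward m12.
have I1 : m1.-integrable setT (EFin \o (u \o phi)).
  apply/integrableP; split.
    by apply/measurable_EFinP; exact: measurableT_comp.
  move/integrableP : Iu => [_]; rewrite m21 ge0_integral_pushforward//.
  by apply: measurableT_comp => //; exact/measurable_EFinP.
split=> //; congr fine; rewrite m21 integral_pushforward//.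
exact/measurable_EFinP.
Qed.

Section transport.
Context {R : realType} {d : nat}.
Local Notation Rd := ('rV[R]_d).
Local Notation E := (borelRd R d).
Implicit Types (mu nu : probability E R) (p k : R).

Lemma powR_cost_measurable p :
  measurable_fun setT (fun z : E * E => enorm ((z.1 : Rd) - (z.2 : Rd)) `^ p).
Proof. exact: (measurableT_comp (measurable_powR p) measurable_dist_enorm). Qed.

Lemma enorm_measurable : measurable_fun setT (fun y : E => enorm (y : Rd)).
Proof. by apply: continuous_borel_measurable; exact: continuous_enorm. Qed.

Lemma moment_measurable p :
  measurable_fun setT (fun y : E => enorm (y : Rd) `^ p).
Proof. exact: (measurableT_comp (measurable_powR p) enorm_measurable). Qed.

Lemma moment_integrable p mu : finite_moment p mu ->
  mu.-integrable setT (EFin \o (fun y : E => enorm (y : Rd) `^ p)).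
Proof.
move=> h; apply/integrableP; split.
  by apply/measurable_EFinP; exact: moment_measurable.
by under eq_integral => y _ do rewrite /= ger0_norm ?powR_ge0//.
Qed.

Lemma coupling_snd mu nu pi (u : E -> R) : coupling mu nu pi ->
  measurable_fun setT u -> nu.-integrable setT (EFin \o u) ->
  pi.-integrable setT (EFin \o (fun z => u z.2)) /\
  \int[pi]_z u z.2 = \int[nu]_y u y.
Proof.
move=> piC mu_ Iu; have [h1 h2] := image_measure_integral measurable_snd mu_
  (fun U mU => (piC U mU).2) Iu.
by split.
Qed.

Lemma coupling_fst mu nu pi (u : E -> R) : coupling mu nu pi ->
  measurable_fun setT u -> mu.-integrable setT (EFin \o u) ->
  pi.-integrable setT (EFin \o (fun z => u z.1)) /\
  \int[pi]_z u z.1 = \int[mu]_y u y.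
Proof.
move=> piC mu_ Iu; have [h1 h2] := image_measure_integral measurable_fst mu_
  (fun U mU => (piC U mU).1) Iu.
by split.
Qed.

(** The infimum over couplings is approached with a slack [e], which spares the
    compactness argument for its attainment. *)
Lemma wasserstein_coupling p mu nu k (e : R) : 0 < p -> 0 <= k -> 0 < e ->
  (wasserstein p mu nu <= k%:E)%E ->
  exists2 pi, coupling mu nu pi &
   (\int[pi]_z (enorm ((z.1 : Rd) - (z.2 : Rd)) `^ p)%:E < (k `^ p + e)%:E)%E.
Proof.
move=> p0 k0 e0; rewrite /wasserstein; set I := ereal_inf _ => Ik.
have I0 : (0 <= I)%E.
  by apply/ereal_infP => _ [pi _ <-]; apply: integral_ge0 => z _; rewrite lee_fin powR_ge0.
have : (I <= (k `^ p)%:E)%E.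
  rewrite -(@poweRe1 _ I)// -[X in (I `^ X)%E](mulVf (lt0r_neq0 p0)) poweRrM.
  rewrite -poweR_EFin; apply: (gt0_ler_poweR (ltW p0)) => //.
    by rewrite in_itv/= poweR_ge0 leey.
  by rewrite in_itv/= lee_fin k0 leey.
move=> Ikp.
have : (I < (k `^ p + e)%:E)%E by rewrite (le_lt_trans Ikp)// lte_fin ltrDl.
by move=> /ereal_inf_lt [_ [pi piC <-] h]; exists pi.
Qed.

(** The easy half of Kantorovich duality: integrate the pointwise inequality
    against a coupling whose cost is almost optimal. *)
Lemma transport_le p mu nu k (u v : E -> R) (al be : R) : 0 < p -> 0 <= k ->
  (wasserstein p mu nu <= k%:E)%E -> 0 <= be ->
  measurable_fun setT u -> nu.-integrable setT (EFin \o u) ->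
  measurable_fun setT v -> mu.-integrable setT (EFin \o v) ->
  (forall y z, u z <= v y + al + be * enorm ((y : Rd) - (z : Rd)) `^ p) ->
  \int[nu]_y u y <= \int[mu]_y v y + al + be * k `^ p.
Proof.
move=> p0 k0 W be0 mu_ Iu mv Iv H; apply/ler_addgt0Pr => e e0.
have be1 : 0 < be + 1 by rewrite ltr_wpDl.
have [pi piC cost] := wasserstein_coupling p0 k0 (divr_gt0 e0 be1) W.
have [Iu' uE] := coupling_snd piC mu_ Iu.
have [Iv' vE] := coupling_fst piC mv Iv.
pose c (z : E * E) := enorm ((z.1 : Rd) - (z.2 : Rd)) `^ p.
have Ic : pi.-integrable setT (EFin \o c).
  apply/integrableP; split; first by apply/measurable_EFinP; exact: powR_cost_measurable.
  under eq_integral => y _ do rewrite /= ger0_norm ?powR_ge0//.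
  by rewrite (lt_trans cost) ?ltry.
rewrite -uE -vE.
apply: (@le_trans _ _ (\int[pi]_z (1 * v z.1 + be * c z + al))).
  apply: le_Rintegral => //; first exact: integrable_affine.
  by move=> z _; apply: (le_trans (H z.1 z.2)); rewrite mul1r addrAC.
rewrite Rintegral_affine// mul1r.
rewrite (_ : _ + e = \int[pi]_z v z.1 + (be * k `^ p + e) + al); last by ring.
rewrite lerD2r lerD2l.
have cle : \int[pi]_z c z <= k `^ p + e / (be + 1).
  by rewrite -lee_fin fineK ?integrable_fin_num// ltW.
apply: (le_trans (ler_wpM2l be0 cle)); rewrite mulrDr lerD2l.
by rewrite mulrA ler_pdivrMr// mulrC ler_pM2l// lerDl.
Qed.

(** The tangent at [r = k] to the convex function [r `^ p].  It turns a bound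
    [k `^ p] on the mean of [r `^ p] into the bound [k] on the mean of [r]
    without any integrability of [r]. *)
Lemma tangent_powR p k (r : R) : 1 < p -> 0 < k -> 0 <= r ->
  r <= k * (1 - p^-1) + k / p / k `^ p * r `^ p.
Proof.
move=> p1 k0 r0; have p0 : 0 < p by lra.
have pV : p^-1 < 1 by rewrite invf_lt1.
have q0 : 0 < (1 - p^-1)^-1 by rewrite invr_gt0 subr_gt0.
have pq : p^-1 + (1 - p^-1)^-1^-1 = 1 by rewrite invrK addrC subrK.
have := conjugate_powR (divr_ge0 r0 (ltW k0)) ler01 p0 q0 pq.
rewrite powR1 mulr1 mul1r invrK.
rewrite powRM ?invr_ge0 ?(ltW k0)// -(ler_pM2l k0) mulrCA divff ?gt_eqF// mulr1.
move=> /le_trans; apply; rewrite mulrDr [leLHS]addrC lerD2l.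
have kVE : (k^-1) `^ p = (k `^ p)^-1.
  by rewrite -powR_inv1 ?ltW// -powRrM mulN1r powRN.
by rewrite kVE le_eqVlt; apply/orP; left; apply/eqP; ring.
Qed.

Lemma transport_lip p mu nu k (u : E -> R) (L M : R) : 1 < p -> 0 < k -> 0 <= L ->
  (wasserstein p mu nu <= k%:E)%E ->
  elip L (u : Rd -> R) -> (forall x, `|u x| <= M) ->
  \int[nu]_y u y <= \int[mu]_y u y + L * k.
Proof.
move=> p1 k0 L0 W uL uM; have p0 : 0 < p by lra.
have mu_ : measurable_fun setT u.
  by apply: continuous_borel_measurable; exact: elip_continuous uL.
have kp : 0 < k `^ p by exact: powR_gt0.
have := @transport_le p mu nu k u u (L * (k * (1 - p^-1))) (L * (k / p / k `^ p))
  p0 (ltW k0) W _ mu_ (bounded_integrable nu mu_ uM) mu_ (bounded_integrable mu mu_ uM).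
rewrite (_ : _ + _ + _ * k `^ p = \int[mu]_y u y + L * k); last first.
  by field; rewrite !gt_eqF.
apply; first by rewrite !mulr_ge0// ?invr_ge0 ?ltW.
move=> y z; rewrite -addrA -mulrA -mulrDr.
have := uL z y; have := tangent_powR p1 k0 (enorm_ge0 ((y : Rd) - (z : Rd))).
move=> /(ler_wpM2l L0) h1; rewrite ler_norml enorm_distC => /andP [_ h2].
by lra.
Qed.

End transport.

Section translation.
Context {R : realType} {d : nat}.
Local Notation Rd := ('rV[R]_d).
Local Notation E := (borelRd R d).
Implicit Types (mu : probability E R) (v : Rd) (p : R).

Definition translate v : E -> E := fun y => (y : Rd) + v.

Lemma measurable_translate v : measurable_fun setT (translate v).
Proof.
apply: continuous_borel_measurableRd => y.
exact: (@cvgD _ _ _ (nbhs y) _ id (cst v) y v cvg_id (cvg_cst v)).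
Qed.

HB.instance Definition _ v :=
  isMeasurableFun.Build _ _ _ _ (translate v) (measurable_translate v).

Definition graph_translate v : E -> (E * E)%type := fun y => (y, translate v y).

Lemma measurable_graph_translate v : measurable_fun setT (graph_translate v).
Proof. by apply/measurable_fun_pair => //; exact: measurable_translate. Qed.

HB.instance Definition _ v :=
  isMeasurableFun.Build _ _ _ _ (graph_translate v) (measurable_graph_translate v).

Lemma coupling_translate mu v :
  coupling mu (distribution mu (translate v)) (distribution mu (graph_translate v)).
Proof. by move=> U mU; split. Qed.

(** From [|y + v| <= 2 max (|y|, |v|)]. *)
Lemma finite_moment_translate p mu v : 0 <= p ->
  finite_moment p mu -> finite_moment p (distribution mu (translate v)).
Proof.
move=> p0 mup; rewrite /finite_moment.
have mm : measurable_fun setT (fun y : E => (enorm (y : Rd) `^ p)%:E).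
  by apply/measurable_EFinP; exact: moment_measurable.
rewrite (ge0_integral_distribution _ mm); last first.
  by move=> y; rewrite lee_fin powR_ge0.
pose c := 2 `^ p.
have := integrable_affine c 0 (c * enorm v `^ p)
  (moment_integrable mup) (moment_integrable mup).
move=> Ic; apply: le_lt_trans (integrable_lty measurableT Ic).
apply: ge0_le_integral => //=.
- by move=> y _; rewrite lee_fin powR_ge0.
- exact: measurableT_comp mm (measurable_translate v).
- by have /integrableP[] := Ic.
- move=> y _; rewrite lee_fin mul0r addr0 -mulrDr.
  have [yv|vy] := leP (enorm (y : Rd)) (enorm v).
    apply: (@le_trans _ _ ((2 * enorm v) `^ p)).
      rewrite ge0_ler_powR ?nnegrE ?enorm_ge0 ?mulr_ge0 ?enorm_ge0//.
      by rewrite (le_trans (enormD _ _))// mulr2n mulrDl mul1r lerD2r.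
    by rewrite powRM ?enorm_ge0// ler_wpM2l ?powR_ge0// lerDr powR_ge0.
  apply: (@le_trans _ _ ((2 * enorm (y : Rd)) `^ p)).
    rewrite ge0_ler_powR ?nnegrE ?enorm_ge0 ?mulr_ge0 ?enorm_ge0//.
    by rewrite (le_trans (enormD _ _))// mulr2n mulrDl mul1r lerD2l ltW.
  by rewrite powRM ?enorm_ge0// ler_wpM2l ?powR_ge0// lerDl powR_ge0.
Qed.

(** All the mass moves by the same vector, so the cost of the graph coupling is
    constant. *)
Lemma wasserstein_translate p mu v : 0 < p ->
  (wasserstein p mu (distribution mu (translate v)) <= (enorm v)%:E)%E.
Proof.
move=> p0; rewrite /wasserstein; set I := ereal_inf _.
have I0 : (0 <= I)%E.
  by apply/ereal_infP => _ [pi _ <-]; apply: integral_ge0 => z _; rewrite lee_fin powR_ge0.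
have IE : (I <= (enorm v `^ p)%:E)%E.
  apply: ge_ereal_inf; exists (enorm v `^ p)%:E => //=.
  exists (distribution mu (graph_translate v)); first exact: coupling_translate.
  have mc : measurable_fun setT
      (fun z : E * E => (enorm ((z.1 : Rd) - (z.2 : Rd)) `^ p)%:E).
    by apply/measurable_EFinP; exact: powR_cost_measurable.
  rewrite (ge0_integral_distribution _ mc); last first.
    by move=> z; rewrite lee_fin powR_ge0.
  rewrite (eq_integral (fun=> (enorm v `^ p)%:E)); last first.
    by move=> y _; rewrite /= opprD addrA subrr add0r enormN.
  by rewrite integral_cst// [X in (_ * X)%E](@probability_setT _ _ _ mu) mule1.
apply: (@le_trans _ _ ((enorm v `^ p)%:E `^ p^-1)%E).
  apply: gt0_ler_poweR => //; first by rewrite invr_ge0 ltW.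
    by rewrite in_itv/= I0 leey.
  by rewrite in_itv/= lee_fin powR_ge0 leey.
by rewrite poweR_EFin -powRrM mulfV ?gt_eqF// powRr1 ?enorm_ge0.
Qed.

Lemma Rintegral_translate mu v (u : E -> R) (M : R) :
  measurable_fun setT u -> (forall y, `|u y| <= M) ->
  \int[distribution mu (translate v)]_y u y = \int[mu]_y u (translate v y).
Proof.
move=> mu_ uM; apply/esym.
apply: (@image_measure_integral _ _ _ _ _ mu _ (translate v) u _ mu_ _ _).2.
- exact: measurable_translate.
- by [].
- exact: bounded_integrable uM.
Qed.

End translation.

(** * The operators on bounded Lipschitz functions *)

Section prob_bounds.
Context {dd : measure_display} {T : measurableType dd} {R : realType}
        (P : probability T R).
Implicit Types f g : T -> R.

Lemma prob_Rintegral_le f (c : R) : P.-integrable setT (EFin \o f) ->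
  (forall x, f x <= c) -> \int[P]_x f x <= c.
Proof.
move=> If fc; rewrite -[leRHS](prob_Rintegral_cst P c).
by apply: le_Rintegral => //; exact: integrable_cst.
Qed.

Lemma prob_Rintegral_ge f (c : R) : P.-integrable setT (EFin \o f) ->
  (forall x, c <= f x) -> c <= \int[P]_x f x.
Proof.
move=> If fc; rewrite -[leLHS](prob_Rintegral_cst P c).
by apply: le_Rintegral => //; exact: integrable_cst.
Qed.

End prob_bounds.

Section blip.
Context {R : realType} {d : nat}.
Local Notation Rd := ('rV[R]_d).
Local Notation E := (borelRd R d).

(** A class of bounded Lipschitz functions preserved by all the operators: its
    members are continuous, hence Borel, and the bounds survive suprema and
    infima of arbitrary families. *)
Definition blip (M L : R) (u : Rd -> R) := (forall x, `|u x| <= M) /\ elip L u.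

Lemma elip_translate L (u : Rd -> R) w : elip L u -> elip L (fun z => u (w + z)).
Proof.
move=> uL x y; apply: (le_trans (uL _ _)).
by rewrite opprD addrACA subrr add0r.
Qed.

Lemma blip_measurable M L (u : Rd -> R) w : blip M L u ->
  measurable_fun setT (fun z : E => u (w + (z : Rd))).
Proof.
by move=> [_ uL]; apply: continuous_borel_measurable;
  apply: (@elip_continuous _ _ L); exact: elip_translate.
Qed.

Lemma blip_integrable M L (u : Rd -> R) (nu : probability E R) w : blip M L u ->
  nu.-integrable setT (EFin \o (fun z : E => u (w + (z : Rd)))).
Proof.
move=> uML; apply: (@bounded_integrable _ _ _ _ _ M).
  exact: blip_measurable uML.
by move=> z; exact: uML.1.
Qed.

Lemma blip_Rintegral_bound M L (u : Rd -> R) (nu : probability E R) w :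
  blip M L u -> `|\int[nu]_z u (w + (z : Rd))| <= M.
Proof.
move=> uML; rewrite ler_norml; apply/andP; split.
  apply: prob_Rintegral_ge; first exact: blip_integrable uML.
  by move=> z; have := uML.1 (w + (z : Rd)); rewrite ler_norml => /andP[].
apply: prob_Rintegral_le; first exact: blip_integrable uML.
by move=> z; have := uML.1 (w + (z : Rd)); rewrite ler_norml => /andP[].
Qed.

Lemma blip_Rintegral_shift M L (u : Rd -> R) (nu : probability E R) w w' :
  blip M L u ->
  \int[nu]_z u (w + (z : Rd)) <= \int[nu]_z u (w' + (z : Rd)) + L * enorm (w - w').
Proof.
move=> uML; have I v := blip_integrable nu v uML.
have := Rintegral_affine 1 0 (L * enorm (w - w')) (I w') (I w').
rewrite mul1r mul0r addr0 => <-; apply: le_Rintegral => //.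
  exact: integrable_affine.
move=> z _; rewrite mul1r mul0r addr0.
have := uML.2 (w + (z : Rd)) (w' + (z : Rd)).
rewrite (_ : w + (z : Rd) - (w' + (z : Rd)) = w - w'); last first.
  by rewrite opprD addrACA subrr addr0.
by rewrite ler_norml => /andP[_]; lra.
Qed.

End blip.

Section operators.
Context {R : realType} {d : nat} {A : Type}.
Local Notation Rd := ('rV[R]_d).
Local Notation E := (borelRd R d).
Context (p m : R) (mu : A -> R -> probability E R) (psi : A -> R -> Rd -> Rd).
Hypotheses (p_gt1 : 1 < p) (m_ge0 : 0 <= m) (A_neq0 : inhabited A).
Hypothesis mu_moment : forall (a : A) (t : R), 0 <= t -> finite_moment p (mu a t).
Local Notation I_op := (I_op p m mu psi).
Local Notation wball := (wball p m mu).

Lemma wball_translate a t v : 0 <= t -> enorm v <= t * m ->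
  wball a t (distribution (mu a t) (translate v)).
Proof.
move=> t0 vt; split.
  by apply: finite_moment_translate; [exact: (le_trans ler01 (ltW p_gt1))|exact: mu_moment].
apply: (le_trans (wasserstein_translate _ _ _)); first exact: (lt_trans ltr01 p_gt1).
by rewrite lee_fin.
Qed.

Lemma I_op_set_bound M L u a t x : blip M L u ->
  ubound [set \int[nu]_z u (psi a t x + (z : Rd)) | nu in wball a t] M.
Proof.
move=> uML _ [nu _ <-]; have := blip_Rintegral_bound nu (psi a t x) uML.
by rewrite ler_norml => /andP[].
Qed.

Lemma wball_neq0 a t : 0 <= t -> exists nu, wball a t nu.
Proof.
move=> t0; exists (distribution (mu a t) (translate 0)).
by apply: wball_translate => //; rewrite enorm0 mulr_ge0.
Qed.

Lemma I_op_inner_bound M L u a t x : 0 <= t -> blip M L u ->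
  `|sup [set \int[nu]_z u (psi a t x + (z : Rd)) | nu in wball a t]| <= M.
Proof.
move=> t0 uML; have [nu nuB] := wball_neq0 a t0.
have nuS : [set \int[nu]_z u (psi a t x + (z : Rd)) | nu in wball a t]
   (\int[nu]_z u (psi a t x + (z : Rd))) by exists nu.
rewrite ler_norml; apply/andP; split.
  have := blip_Rintegral_bound nu (psi a t x) uML.
  rewrite ler_norml => /andP[+ _] => /le_trans; apply.
  by apply: ub_le_sup => //; exists M; exact: I_op_set_bound uML.
apply: ge_sup; first by eexists; exact: nuS.
exact: I_op_set_bound uML.
Qed.

Lemma I_op_ge M L u t x l : 0 <= t -> blip M L u ->
  (forall a, exists2 nu, wball a t nu & l <= \int[nu]_z u (psi a t x + (z : Rd))) ->
  l <= I_op t u x.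
Proof.
move=> t0 uML H; apply: lb_le_inf.
  by have [a] := A_neq0; eexists; exists a.
move=> _ [a _ <-]; have [nu nuB /le_trans] := H a; apply.
apply: ub_le_sup; first by exists M; exact: I_op_set_bound uML.
by exists nu.
Qed.

Lemma I_op_le M L u t x l a : 0 <= t -> blip M L u ->
  (forall nu, wball a t nu -> \int[nu]_z u (psi a t x + (z : Rd)) <= l) ->
  I_op t u x <= l.
Proof.
move=> t0 uML H.
apply: (@le_trans _ _ (sup [set \int[nu]_z u (psi a t x + (z : Rd)) | nu in wball a t])).
  apply: ge_inf; last by exists a.
  exists (- M) => _ [b _ <-].
  by have := I_op_inner_bound b x t0 uML; rewrite ler_norml => /andP[].
apply: ge_sup; last by move=> _ [nu /H nul <-].
by have [nu nuB] := wball_neq0 a t0; eexists; exists nu.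
Qed.

Lemma I_op_bound M L u t x : 0 <= t -> blip M L u -> `|I_op t u x| <= M.
Proof.
move=> t0 uML; have B a nu := blip_Rintegral_bound nu (psi a t x) uML.
rewrite ler_norml; apply/andP; split.
  apply: (I_op_ge t0 uML) => a; have [nu nuB] := wball_neq0 a t0.
  by exists nu => //; have := B a nu; rewrite ler_norml => /andP[].
have [a] := A_neq0; apply: (I_op_le (a := a) t0 uML) => nu nuB.
by have := B a nu; rewrite ler_norml => /andP[].
Qed.

Lemma I_op_elip M L u t k : 0 <= t -> 0 <= L -> blip M L u ->
  (forall a x y, enorm (psi a t x - psi a t y) <= k * enorm (x - y)) ->
  elip (L * k) (I_op t u).
Proof.
move=> t0 L0 uML psik.
apply: elip_of_le => x y; rewrite -lerBlDr; apply: lb_le_inf.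
  by have [a] := A_neq0; eexists; exists a.
move=> _ [a _ <-]; rewrite lerBlDr; apply: (I_op_le (a := a) t0 uML) => nu nuB.
apply: (le_trans (blip_Rintegral_shift nu _ (psi a t y) uML)).
rewrite -mulrA lerD//; last by rewrite ler_wpM2l.
apply: ub_le_sup; first by exists M; exact: I_op_set_bound uML.
by exists nu.
Qed.

Variable c : R.
Hypothesis psi_lip : forall (a : A) (t : R) (x y : Rd), 0 <= t ->
  enorm (psi a t x - psi a t y) <= expR (c * t) * enorm (x - y).

Lemma I_op_blip M L u t : 0 <= t -> 0 <= L -> blip M L u ->
  blip M (L * expR (c * t)) (I_op t u).
Proof.
move=> t0 L0 uML; split; first by move=> x; exact: I_op_bound uML.
by apply: I_op_elip uML _ => // a x y; exact: psi_lip.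
Qed.

Lemma path_last_ge (u : R) (l : seq R) : path <%R u l -> u <= last u l.
Proof.
elim: l u => [|v l IH] u //= /andP[uv vl]; apply: (le_trans (ltW uv)); exact: IH.
Qed.

Lemma I_chain_blip M L u (s : R) l : 0 <= L -> blip M L u -> path <%R s l ->
  blip M (L * expR (c * (last s l - s))) (I_chain p m mu psi s l u).
Proof.
move=> L0 uML; elim: l s => [|v l IH] s /=; first by rewrite subrr mulr0 expR0 mulr1.
move=> /andP[sv vl].
have -> : L * expR (c * (last v l - s)) =
    L * expR (c * (last v l - v)) * expR (c * (v - s)).
  by rewrite -mulrA -expRD; congr (_ * expR _); ring.
by apply: I_op_blip; [lra|rewrite mulr_ge0// expR_ge0|exact: IH].
Qed.

Lemma S_op_ge u t x l : 0 < t ->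
  (forall s, partitions t s -> l <= I_chain p m mu psi 0 s u x) ->
  l <= S_op p m mu psi t u x.
Proof.
move=> t0 H; apply: lb_le_inf; last by move=> _ [s /H ls <-].
by eexists; exists [:: t] => //; split=> //=; rewrite t0.
Qed.

Lemma S_op_le M L u t x s : 0 <= L -> blip M L u -> partitions t s ->
  S_op p m mu psi t u x <= I_chain p m mu psi 0 s u x.
Proof.
move=> L0 uML ts; apply: ge_inf; last by exists s.
exists (- M) => _ [s' [s'p _] <-].
by have [+ _] := I_chain_blip L0 uML s'p => /(_ x); rewrite ler_norml => /andP[].
Qed.

Lemma S_op_blip M L u t : 0 < t -> 0 <= L -> blip M L u ->
  blip M (L * expR (c * t)) (S_op p m mu psi t u).
Proof.
move=> t0 L0 uML; split.
  move=> x; rewrite ler_norml; apply/andP; split.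
    apply: S_op_ge => // s [sp _].
    by have [+ _] := I_chain_blip L0 uML sp => /(_ x); rewrite ler_norml => /andP[].
  have tt : partitions t [:: t] by split=> //=; rewrite t0.
  apply: (le_trans (S_op_le x L0 uML tt)).
  have [+ _] := I_chain_blip L0 uML tt.1.
  by move=> /(_ x); rewrite ler_norml => /andP[].
apply: elip_of_le => x y; rewrite -lerBlDr; apply: S_op_ge => // s st; rewrite lerBlDr.
apply: (le_trans (S_op_le x L0 uML st)).
case: st => sp st; have [_ +] := I_chain_blip L0 uML sp => /(_ x y).
by rewrite st subr0 ler_distl addrC => /andP[_].
Qed.

End operators.

(** * A smooth bump function *)

Section flat_exponential.
Context {R : realType}.

(** For [k = 0] this is the classical flat function [exp (-1/s)]; the
    factors [s^-k] make the family stable under derivation up to linear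
    combinations. *)
Definition flatexp (k : nat) (s : R) : R :=
  if 0 < s then s^-1 ^+ k * expR (- s^-1) else 0.

Lemma flatexp_ge0 k s : 0 <= flatexp k s.
Proof.
rewrite /flatexp; case: ifPn => // s0.
by rewrite mulr_ge0 ?expR_ge0// exprn_ge0// invr_ge0 ltW.
Qed.

(** Quadratic decay at [0] makes the derivative vanish there; it comes
    from [exp u >= u^(k+2) / (k+2)!] at [u = 1/s]. *)
Lemma flatexp_le k s : flatexp k s <= k.+2`!%:R * s ^+ 2.
Proof.
rewrite /flatexp; case: ifPn => s0; last by rewrite mulr_ge0// sqr_ge0.
have F : (0 : R) < k.+2`!%:R by rewrite ltr0n fact_gt0.
have := expR_ge1Dxn k.+1 (ltW (eqbRL (invr_gt0 s) s0)).
set u := s^-1 => /(le_trans (ltW (ltr_pwDl ltr01 (lexx _)))).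
have u0 : 0 < u by rewrite invr_gt0.
rewrite ler_pdivrMr// => H.
rewrite expRN ler_pdivrMr ?expR_gt0// (_ : u ^+ k = u ^+ k.+2 * s ^+ 2); last first.
  by rewrite -addn2 exprD -mulrA -exprMn mulVf ?gt_eqF// expr1n mulr1.
by rewrite [leRHS]mulrAC ler_wpM2r ?sqr_ge0// mulrC.
Qed.

Lemma is_derive_flatexp (k : nat) (s : R) :
  is_derive s 1 (flatexp k) (flatexp k.+2 s - k%:R * flatexp k.+1 s).
Proof.
have [s0|s0|<-] := ltrgtP 0 s.
- pose g (r : R) := r^-1 ^+ k * expR (- r^-1).
  apply: (@near_eq_is_derive _ _ _ g).
    near=> r; rewrite /flatexp ifT//; near: r; exact: lt_nbhsr.
  have sn0 : s != 0 by rewrite gt_eqF.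
  have hv : is_derive s 1 (fun r : R => r^-1) (- s ^- 2 *: 1).
    exact: (is_deriveV (f := id)).
  have hp := is_deriveX k hv.
  have he := @is_derive1_comp R expR (fun r : R => - r^-1) s _ _
    (is_derive_expR (- s^-1)) (is_deriveN hv).
  have hm := is_deriveM hp he.
  have -> : g = (fun r : R => r^-1) ^+ k * (expR \o (fun r : R => - r^-1)).
    by apply/funext => r; rewrite /g fctE exprfctE.
  apply: (is_derive_eq hm).
  rewrite /flatexp s0 exprfctE /GRing.scale/=.
  case: k {g hp hm} => [|k]; rewrite ?mulr0n ?expr0 ?mul0r -?exprVn.
    by ring.
  by rewrite -pred_Sn !exprS; ring.
- apply: (@near_eq_is_derive _ _ _ (cst 0)).
    near=> r; rewrite /flatexp ifN// -leNgt ltW//; near: r; exact: lt_nbhsl.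
  apply: is_derive_eq.
  by rewrite /flatexp !ifN ?mulr0 ?subr0// -leNgt ltW.
- have e0 j : flatexp j 0 = 0 by rewrite /flatexp ltxx.
  have lim0 : h^-1 *: ((flatexp k (h *: 1 + 0)) - flatexp k 0) @[h --> 0^'] --> (0 : R).
    pose F : R := k.+2`!%:R.
    have F0 : 0 < F by rewrite ltr0n fact_gt0.
    apply/cvgr0Pnorm_le => e ee; near=> h.
    have h0 : h != 0 by near: h; exact: nbhs_dnbhs_neq.
    rewrite e0 subr0 addr0 /GRing.scale/= mulr1 normrM normfV.
    rewrite ler_pdivrMl ?normr_gt0// ger0_norm ?flatexp_ge0//.
    apply: (le_trans (flatexp_le _ _)).
    rewrite -real_normK ?num_real// expr2 mulrCA ler_wpM2l//.
    rewrite -ler_pdivlMl//.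
    near: h; apply: dnbhs0_le; by rewrite mulr_gt0// invr_gt0.
  rewrite !e0 mulr0 subr0; apply: DeriveDef; first by apply/cvg_ex; exists 0.
  exact/cvg_lim.
Unshelve. all: by end_near. Qed.

End flat_exponential.

Section bump.
Context {R : realType} {d : nat}.
Local Notation Rd := ('rV[R]_d).
Implicit Types (f g : Rd -> R).

(** An algebra of differentiable functions stable under partial derivatives, so
    that all its members are smooth, by induction on the derivatives taken. *)
Inductive bump_algebra : (Rd -> R) -> Prop :=
| bump_cst c : bump_algebra (fun=> c)
| bump_coord i : bump_algebra (fun x => x 0 i)
| bump_flat k : bump_algebra (fun x => flatexp k (1 - dot x x))
| bump_add f g : bump_algebra f -> bump_algebra g ->
    bump_algebra (fun x => f x + g x)
| bump_mul f g : bump_algebra f -> bump_algebra g ->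
    bump_algebra (fun x => f x * g x).

Let C1 f := (forall x, differentiable f x) /\ forall i, bump_algebra (partial i f).

Let C1_cst c : C1 (fun=> c).
Proof.
split=> [x|i]; first exact: differentiable_cst.
rewrite (_ : partial i _ = fun=> 0); first exact: bump_cst.
by apply/funext => x; exact: derive_cst.
Qed.

Let C1_coord j : C1 (fun x => x 0 j).
Proof.
split=> [x|i]; first exact: differentiable_coord.
rewrite (_ : partial i _ = fun=> (delta_mx 0 i : Rd) 0 j); first exact: bump_cst.
apply/funext => x; rewrite /partial deriveE; last exact: differentiable_coord.
pose l : Rd -> R := fun x => x 0 j.
have ll : linear l by move=> a u v; rewrite /l !mxE.
pose L : {linear Rd -> R} := HB.pack l (GRing.isLinear.Build _ _ _ _ _ ll).
have Lc : continuous L by move=> u; exact: coord_continuous.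
by rewrite (_ : (fun y : Rd => y 0 j) = L)// diff_lin.
Qed.

Let C1_add f g : bump_algebra f -> bump_algebra g -> C1 f -> C1 g ->
  C1 (fun x => f x + g x).
Proof.
move=> _ _ [df pf] [dg pg]; split=> [x|i]; first exact: differentiableD.
rewrite (_ : partial i _ = fun x => partial i f x + partial i g x).
  exact: bump_add.
by apply/funext => x; apply: deriveD; exact: diff_derivable.
Qed.

Let C1_mul f g : bump_algebra f -> bump_algebra g -> C1 f -> C1 g ->
  C1 (fun x => f x * g x).
Proof.
move=> af ag [df pf] [dg pg]; split=> [x|i]; first exact: differentiableM.
rewrite (_ : partial i _ = fun x => f x * partial i g x + g x * partial i f x).
  by apply: bump_add; exact: bump_mul.
by apply/funext => x; apply: deriveM; exact: diff_derivable.
Qed.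

Let C1_quad : C1 (fun x => 1 - dot x x).
Proof.
pose P f := bump_algebra f /\ C1 f.
have Pcst c : P (fun=> c) by split; [exact: bump_cst|exact: C1_cst].
have Pcoord i : P (fun x => x 0 i) by split; [exact: bump_coord|exact: C1_coord].
have Padd f g : P f -> P g -> P (fun x => f x + g x).
  by move=> [af Cf] [ag Cg]; split; [exact: bump_add|exact: C1_add].
have Pmul f g : P f -> P g -> P (fun x => f x * g x).
  by move=> [af Cf] [ag Cg]; split; [exact: bump_mul|exact: C1_mul].
have -> : (fun x : Rd => 1 - dot x x) = (fun x : Rd => 1 + -1 * dot x x).
  by apply/funext => x; rewrite mulN1r.
suff [_] : P (fun x => 1 + -1 * dot x x) by [].
apply/(Padd _ _ (Pcst 1))/(Pmul _ _ (Pcst (-1))); rewrite /dot.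
have : forall s : seq 'I_d, P (fun x => \sum_(i <- s) x 0 i * x 0 i).
  elim=> [|i s IH].
    rewrite (_ : (fun x => _) = fun=> 0)//.
    by apply/funext => x; rewrite big_nil.
  rewrite (_ : (fun x => _) =
      (fun x : Rd => x 0 i * x 0 i + \sum_(i <- s) x 0 i * x 0 i)).
    by apply: Padd => //; exact: Pmul.
  by apply/funext => x; rewrite big_cons.
exact.
Qed.

Let C1_flat k : C1 (fun x => flatexp k (1 - dot x x)).
Proof.
have [dq pq] := C1_quad; set q : Rd -> R := fun x => _ in dq pq.
have df s : differentiable (flatexp k) s.
  by apply/derivable1_diffP; have [] := is_derive_flatexp k s.
split=> [x|i]; first by apply: (@differentiable_comp _ _ _ _ q (flatexp k)).
rewrite (_ : partial i _ = fun x =>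
    (flatexp k.+2 (q x) + - k%:R * flatexp k.+1 (q x)) * partial i q x).
  apply: bump_mul => //; apply: bump_add; first exact: bump_flat.
  by apply: bump_mul; [exact: bump_cst|exact: bump_flat].
apply/funext => x; rewrite /partial deriveE; last first.
  exact: (@differentiable_comp _ _ _ _ q (flatexp k)).
rewrite -[(fun y => _)]/(flatexp k \o q) diff_comp//= deriv1E; last first.
  by have [] := is_derive_flatexp k (q x).
rewrite derive1E -deriveE// mulNr /GRing.scale/= mulrC; congr (_ * _).
by have [_ ->] := is_derive_flatexp k (q x).
Qed.

Lemma bump_algebra_partial f : bump_algebra f -> C1 f.
Proof.
elim=> [c|i|k|{}f g af Cf ag Cg|{}f g af Cf ag Cg].
- exact: C1_cst.
- exact: C1_coord.
- exact: C1_flat.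
- exact: C1_add.
- exact: C1_mul.
Qed.

Lemma bump_algebra_smooth f : bump_algebra f -> smooth f.
Proof.
move=> af s x; suff /bump_algebra_partial[+ _] : bump_algebra (foldr partial f s).
  exact.
by elim: s => //= i s /bump_algebra_partial[].
Qed.

(** The factor [expR 1] normalises the value at the origin to [1]. *)
Definition bump (x : Rd) : R := expR 1 * flatexp 0 (1 - dot x x).

Lemma bump_in_algebra : bump_algebra bump.
Proof. by apply: bump_mul; [exact: bump_cst|exact: bump_flat]. Qed.

Lemma bump_out x : 1 <= enorm x -> bump x = 0.
Proof.
move=> x1; rewrite /bump /flatexp ifN ?mulr0// -leNgt dotxx subr_le0.
by rewrite exprn_ege1.
Qed.

Lemma bump_ge0 x : 0 <= bump x.
Proof. by rewrite mulr_ge0 ?flatexp_ge0// expR_ge0. Qed.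

(** With [q = 1 - |x|^2], the bump is [exp (1 - 1/q)], and
    [exp (1/q - 1) >= 1/q].  Thus [1 - bump] dominates the square on the
    unit ball. *)
Lemma bump_le x : enorm x <= 1 -> bump x <= 1 - enorm x ^+ 2.
Proof.
move=> x1; have [x1'|x1'] := leP 1 (enorm x).
  by rewrite bump_out// subr_ge0 exprn_ile1 ?enorm_ge0.
have q0 : 0 < 1 - enorm x ^+ 2.
  by rewrite subr_gt0 exprn_ilt1 ?enorm_ge0.
rewrite /bump /flatexp dotxx q0 expr0 mul1r -expRD.
set q := 1 - _ in q0 *.
have e1 := expR_ge1Dx (q^-1 - 1).
rewrite -opprB expRN -[leRHS]invrK lef_pV2 ?posrE ?expR_gt0 ?invr_gt0//.
by apply: le_trans e1; rewrite addrC subrK.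
Qed.

Lemma bump0 : bump 0 = 1.
Proof.
have d0 : dot (0 : Rd) 0 = 0 by rewrite dotxx enorm0 expr0n.
by rewrite /bump d0 subr0 /flatexp ltr01 expr0 mul1r invr1 -expRD subrr expR0.
Qed.

Lemma bump_le1 x : bump x <= 1.
Proof.
have [x1|x1] := leP 1 (enorm x); first by rewrite bump_out.
by apply: (le_trans (bump_le (ltW x1))); rewrite gerBl sqr_ge0.
Qed.

Lemma bump_compact_support f : bump_algebra f ->
  (forall x, 1 <= enorm x -> f x = 0) -> Ccinfty f.
Proof.
move=> af f0; split; first exact: bump_algebra_smooth.
apply: (@subclosed_compact _ _ [set x : Rd | enorm x <= 1]).
- exact: closed_closure.
- exact: compact_enorm_ball.
- have /closure_id -> : closed [set x : Rd | enorm x <= 1].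
    by apply: compact_closed; [exact: norm_hausdorff|exact: compact_enorm_ball].
  apply: closureS => x /= /eqP fx.
  by rewrite leNgt; apply/negP => /ltW /f0.
Qed.

Lemma Ccinfty_bump : Ccinfty bump.
Proof. by apply: bump_compact_support bump_out; exact: bump_in_algebra. Qed.

Definition coord_bump (i : 'I_d) (x : Rd) : R := x 0 i * bump x.

Lemma Ccinfty_coord_bump i : Ccinfty (coord_bump i).
Proof.
apply: bump_compact_support.
  by apply: bump_mul; [exact: bump_coord|exact: bump_in_algebra].
by move=> x x1; rewrite /coord_bump bump_out// mulr0.
Qed.

End bump.

(** * Confinement near a point *)

Section confinement_function.
Context {R : realType} {d : nat}.
Local Notation Rd := ('rV[R]_d).
Implicit Types (x y : Rd).

Definition cap (de : R) x : R := Num.min (enorm x ^+ 2) (de ^+ 2).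

Lemma cap_ge0 de x : 0 <= cap de x.
Proof. by rewrite le_min !sqr_ge0. Qed.

Lemma cap_le de x : cap de x <= de ^+ 2.
Proof. by rewrite ge_min lexx orbT. Qed.

Lemma cap0 de : cap de (0 : Rd) = 0.
Proof. by rewrite /cap enorm0 expr0n/= min_l ?sqr_ge0. Qed.

Lemma cap_out de x : 0 <= de -> de <= enorm x -> cap de x = de ^+ 2.
Proof. by move=> de0 dex; rewrite /cap min_r// lerXn2r// nnegrE enorm_ge0. Qed.

Lemma cap_blip de (x0 : Rd) : 0 <= de -> blip (de ^+ 2) (2 * de) (fun x => cap de (x - x0)).
Proof.
move=> de0; split=> [x|].
  by rewrite ger0_norm ?cap_ge0 ?cap_le.
apply: elip_of_le => x y.
suff H u v : cap de u <= cap de v + 2 * de * enorm (u - v).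
  by rewrite (le_trans (H _ (y - x0)))// opprB addrA subrK.
have := enorm_le_dist u v; have := enorm_ge0 (u - v).
have := enorm_ge0 u; have := enorm_ge0 v; have := cap_le de u.
have [vde|dev] := leP (enorm v) de; last first.
  rewrite (cap_out de0 (ltW dev)); nra.
have -> : cap de v = enorm v ^+ 2 by rewrite /cap min_l// lerXn2r// nnegrE enorm_ge0.
have [ude|deu] := leP (enorm u) de; last first.
  by rewrite (cap_out de0 (ltW deu)); nra.
have -> : cap de u = enorm u ^+ 2 by rewrite /cap min_l// lerXn2r// nnegrE enorm_ge0.
by nra.
Qed.

(** The truncated square is an infimum of quadratic functions, whence a
    first order expansion from above with a quadratic error; the bump
    localises it to the unit ball. *)
Lemma cap_expand de x y b : 0 <= de ->
  b = (if enorm x < de then 2 *: x else 0) ->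
  cap de (x + y) <= cap de x + dot b y * bump y + (1 + de) ^+ 2 * (1 - bump y).
Proof.
move=> de0 bE.
have b1 := bump_le1 y; have b0 := bump_ge0 y.
have ble : enorm b <= 2 * de.
  rewrite bE; case: ifPn => [xde|_]; last by rewrite enorm0 mulr_ge0.
  by rewrite enormZ ger0_norm// ler_wpM2l// ltW.
have [y1|y1] := leP 1 (enorm y).
  rewrite bump_out// mulr0 addr0 subr0 mulr1.
  by have := cap_le de (x + y); have := cap_ge0 de x; nra.
have by_ := normr_dot_le b y; move: by_; rewrite ler_norml => /andP[_ by_].
have yle : dot b y <= 2 * de.
  apply: (le_trans by_); apply: le_trans ble; rewrite ler_piMr ?enorm_ge0//.
  exact: ltW.
have bmp := bump_le (ltW y1).
suff : cap de (x + y) <= cap de x + dot b y + enorm y ^+ 2 by nra.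
rewrite bE; case: ifPn => [xde|]; last first.
  rewrite -leNgt => dex; rewrite (cap_out de0 dex).
  have -> : dot 0 y = 0 by rewrite /dot big1// => i _; rewrite mxE mul0r.
  rewrite addr0; apply: (le_trans (cap_le _ _)).
  by rewrite lerDl sqr_ge0.
have -> : cap de x = enorm x ^+ 2.
  by rewrite /cap min_l// lerXn2r// ?nnegrE ?enorm_ge0// ltW.
apply: (@le_trans _ _ (enorm (x + y) ^+ 2)); first by rewrite ge_min lexx.
by rewrite -!dotxx dotDl !dotDr dotZl (dotC y x); lra.
Qed.

End confinement_function.

Section confinement.
Context {R : realType} {d : nat} {A : Type}.
Local Notation Rd := ('rV[R]_d).
Local Notation E := (borelRd R d).
Context (p m : R) (mu : A -> R -> probability E R) (psi : A -> R -> Rd -> Rd).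
Hypotheses (p_gt1 : 1 < p) (m_ge0 : 0 <= m).
Variable C : R.
Hypothesis C_gt0 : 0 < C.
Hypothesis psi_growth : forall (a : A) (t : R) (x : Rd), 0 < t ->
  enorm (psi a t x - x) <= t * C * (1 + enorm x).
Hypothesis mu_smooth : forall chi : Rd -> R, Ccinfty chi ->
  exists K t0 : R, [/\ 0 <= K, 0 < t0 & forall (a : A) (t : R), 0 < t <= t0 ->
   `|\int[mu a t]_y (chi (y : Rd) - chi 0)| <= K * t].

Lemma coord_bump_measurable i :
  measurable_fun setT (fun y : E => coord_bump i (y : Rd)).
Proof.
apply: continuous_borel_measurable => y; apply: differentiable_continuous.
by have [/(_ [::] y)] := Ccinfty_coord_bump (R := R) i.
Qed.

Lemma coord_bump_integrable (nu : probability E R) i :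
  nu.-integrable setT (EFin \o (fun y : E => coord_bump i (y : Rd))).
Proof.
apply: (@bounded_integrable _ _ _ _ _ 1); first exact: coord_bump_measurable.
move=> y; have [y1|y1] := leP 1 (enorm (y : Rd)).
  by rewrite /coord_bump bump_out// mulr0 normr0.
rewrite normrM; apply: mulr_ile1 => //.
  exact: (le_trans (coord_le_enorm _ _) (ltW y1)).
by rewrite ger0_norm ?bump_ge0 ?bump_le1.
Qed.

Lemma bump_integrable (nu : probability E R) :
  nu.-integrable setT (EFin \o (fun y : E => bump (y : Rd))).
Proof.
apply: (@bounded_integrable _ _ _ _ _ 1); last first.
  by move=> y; rewrite ger0_norm ?bump_ge0 ?bump_le1.
apply: continuous_borel_measurable => y; apply: differentiable_continuous.
by have [/(_ [::] y)] := @Ccinfty_bump R d.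
Qed.

(** One time horizon and one constant for the finitely many test functions in
    use. *)
Lemma mu_coord_bump : exists K t0 : R, [/\ 0 <= K, 0 < t0 &
  forall (a : A) (t : R), 0 < t <= t0 ->
   (forall i, `|\int[mu a t]_y coord_bump i (y : Rd)| <= K * t) /\
   \int[mu a t]_y (1 - bump (y : Rd)) <= K * t].
Proof.
have [K [t0 [K0 t00 H]]] := mu_smooth (@Ccinfty_bump R d).
have Hc i := mu_smooth (@Ccinfty_coord_bump R d i).
pose K_ i := projT1 (cid (Hc i)).
have HK i : exists t0 : R, [/\ 0 <= K_ i, 0 < t0 & forall (a : A) (t : R),
   0 < t <= t0 ->
   `|\int[mu a t]_y (coord_bump i (y : Rd) - coord_bump i 0)| <= K_ i * t].
  exact: (projT2 (cid (Hc i))).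
pose t_ i := projT1 (cid (HK i)).
have Ht i := projT2 (cid (HK i)).
exists (K + \sum_i K_ i), (\big[Num.min/t0]_i t_ i); split.
- by rewrite addr_ge0// sumr_ge0// => i _; case: (Ht i).
- by rewrite lt_bigmin// => i _; case: (Ht i).
move=> a t /andP[tp tle]; split=> [i|].
  have [Ki ti /(_ a t)] := Ht i; rewrite tp/= (le_trans tle) ?bigmin_le_cond//.
  move=> /(_ isT); rewrite {2}/coord_bump mxE mul0r.
  under eq_Rintegral => y _ do rewrite subr0.
  move=> /le_trans; apply; rewrite ler_wpM2r ?(ltW tp)//.
  rewrite (bigD1 i)//= addrCA lerDl addr_ge0// sumr_ge0// => j _.
  by case: (Ht j).
have tt0 : t <= t0 by apply: (le_trans tle); exact: bigmin_le_id.
have := H a t; rewrite tp tt0 => /(_ isT); rewrite bump0 ler_norml => /andP[+ _].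
have I := bump_integrable (mu a t).
have -> : \int[mu a t]_y (bump (y : Rd) - 1) = - \int[mu a t]_y (1 - bump (y : Rd)).
  by rewrite !RintegralB ?opprB//; exact: integrable_cst.
rewrite lerN2 => /le_trans; apply.
by rewrite ler_wpM2r ?(ltW tp)// lerDl sumr_ge0// => j _; case: (Ht j).
Qed.

Lemma Rintegral_sum_seq (I : Type) (s : seq I) (nu : probability E R)
    (h : I -> E -> R) : (forall i, nu.-integrable setT (EFin \o h i)) ->
  nu.-integrable setT (EFin \o (fun y => \sum_(i <- s) h i y)) /\
  \int[nu]_y (\sum_(i <- s) h i y) = \sum_(i <- s) \int[nu]_y h i y.
Proof.
move=> Ih; elim: s => [|i s [IH1 IH2]].
  rewrite big_nil; split.
    rewrite (_ : (fun y => _) = fun=> 0); first exact: integrable_cst.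
    by apply/funext => y; rewrite big_nil.
  by under eq_Rintegral => y _ do rewrite big_nil; exact: prob_Rintegral_cst.
have E_ : (fun y => \sum_(j <- i :: s) h j y) =
    (fun y => h i y + \sum_(j <- s) h j y).
  by apply/funext => y; rewrite big_cons.
rewrite E_ big_cons; split; last by rewrite RintegralD// IH2.
by have := integrableD measurableT (Ih i) IH1.
Qed.

(** Over a step of length [h] the mean of the truncated square grows by [O(h)],
    for all controls and all starting points.  The three contributions are the
    Wasserstein displacement, by the Lipschitz bound; the law [mu a h], by
    [cap_expand] and the bounds on test functions; and the flow [psi], whose
    linear growth is harmless because the function is constant far from
    [x0]. *)
Lemma cap_step (r de : R) : 0 < de -> exists K h0 : R, [/\ 0 <= K, 0 < h0 &
  forall (x0 x : Rd) (a : A) (h : R) (nu : probability E R),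
  enorm x0 <= r -> 0 < h <= h0 -> wball p m mu a h nu ->
  \int[nu]_z cap de (psi a h x + (z : Rd) - x0) <= cap de (x - x0) + K * h].
Proof.
move=> de0; have [K [h0 [K0 h00 HK]]] := mu_coord_bump.
pose K1 := 2 * de * (m + 1).
pose K2 := d%:R * (2 * de * K) + (1 + de) ^+ 2 * K.
pose K3 := 2 * de * (C * (1 + `|r| + de)).
have de0' := ltW de0; have C0' := ltW C_gt0.
have K1_ge0 : 0 <= K1 by rewrite /K1 !(mulr_ge0, addr_ge0).
have K2_ge0 : 0 <= K2 by rewrite /K2 !(mulr_ge0, addr_ge0, sqr_ge0).
have K3_ge0 : 0 <= K3 by rewrite /K3 !(mulr_ge0, addr_ge0).
exists (K1 + K2 + K3), h0; split=> //; first exact: addr_ge0 (addr_ge0 K1_ge0 K2_ge0) K3_ge0.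
move=> x0 x a h nu x0r /andP[hp hle] [_ W].
have zB := cap_blip x0 (ltW de0).
pose w := psi a h x.
have step1 : \int[nu]_z cap de (w + (z : Rd) - x0) <=
    \int[mu a h]_z cap de (w + (z : Rd) - x0) + K1 * h.
  have W1 : (wasserstein p (mu a h) nu <= (h * (m + 1))%:E)%E.
    by apply: (le_trans W); rewrite lee_fin ler_pM2l// lerDl.
  have hm : 0 < h * (m + 1) by rewrite mulr_gt0// ltr_wpDl.
  have dd : 0 <= 2 * de by rewrite mulr_ge0// ltW.
  have := transport_lip (M := de ^+ 2) p_gt1 hm dd W1 (elip_translate w zB.2)
    (fun z => zB.1 (w + z)).
  by rewrite /K1 (_ : 2 * de * (h * (m + 1)) = 2 * de * (m + 1) * h)//; ring.
pose b : Rd := if enorm (w - x0) < de then 2 *: (w - x0) else 0.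
have step2 : \int[mu a h]_z cap de (w + (z : Rd) - x0) <= cap de (w - x0) + K2 * h.
  pose F (y : E) := dot b (y : Rd) * bump (y : Rd).
  have [IF FE] := Rintegral_sum_seq (index_enum 'I_d) (nu := mu a h)
    (h := fun i y => b 0 i * coord_bump i (y : Rd))
    (fun i => integrableZl measurableT (b 0 i) (coord_bump_integrable (mu a h) i)).
  have FE' : F = fun y : E => \sum_(i < d) b 0 i * coord_bump i (y : Rd).
    apply/funext => y; rewrite /F /dot mulr_suml.
    by apply: eq_bigr => i _; rewrite /coord_bump mulrA.
  rewrite -FE' in IF.
  have IG : (mu a h).-integrable setT (EFin \o (fun y : E => 1 - bump (y : Rd))).
    have I := bump_integrable (mu a h).
    apply: eq_integrable (integrable_affine (-1) 0 1 I I) => // y _ /=.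
    by rewrite mul0r addr0 mulN1r addrC.
  have [HKc HKb] : (forall i, `|\int[mu a h]_y coord_bump i (y : Rd)| <= K * h) /\
     \int[mu a h]_y (1 - bump (y : Rd)) <= K * h by apply: HK; rewrite hp.
  apply: (@le_trans _ _ (\int[mu a h]_y
     (1 * F y + (1 + de) ^+ 2 * (1 - bump (y : Rd)) + cap de (w - x0)))).
    apply: le_Rintegral => //.
    - exact: (blip_integrable (mu a h) w zB).
    - exact: integrable_affine.
    move=> y _; rewrite mul1r [w + _]addrC -addrA [_ + (w - x0)]addrC.
    have := cap_expand (y : Rd) (ltW de0) (erefl b).
    by rewrite /F; lra.
  rewrite Rintegral_affine// mul1r addrC lerD2l /K2 mulrDl lerD//; last first.
    by rewrite -mulrA ler_wpM2l ?sqr_ge0.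
  rewrite FE' FE -mulrA -[X in X%:R * _]card_ord mulr_natl -sumr_const.
  apply: ler_sum => i _; rewrite RintegralZl//; last exact: coord_bump_integrable.
  apply: (le_trans (ler_norm _)); rewrite normrM -mulrA.
  apply: ler_pM => //; apply: (le_trans (coord_le_enorm _ _)); rewrite /b.
  case: ifPn => [wde|_]; last by rewrite enorm0 mulr_ge0// ltW.
  by rewrite enormZ ger0_norm// ler_pM2l// ltW.
have step3 : cap de (w - x0) <= cap de (x - x0) + K3 * h.
  have [dex|xde] := leP de (enorm (x - x0)).
    rewrite (cap_out (ltW de0) dex); apply: (le_trans (cap_le _ _)).
    by rewrite lerDl mulr_ge0// ltW.
  have [_ /(_ w x)] := zB; rewrite ler_norml => /andP[_ /=].
  have := psi_growth a x hp; rewrite -/w.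
  have : enorm x <= `|r| + de.
    by have := enorm_le_dist x x0; have := ler_norm r; lra.
  move=> xr wx; rewrite /K3 => H.
  have : enorm (w - x) <= h * C * (1 + `|r| + de).
    apply: (le_trans wx); rewrite ler_wpM2l//; last by rewrite -addrA lerD2l.
    by rewrite mulr_ge0// ltW.
  move=> H2; have : 2 * de * enorm (w - x) <= 2 * de * (h * C * (1 + `|r| + de)).
    by rewrite ler_wpM2l// mulr_ge0// ltW.
  by lra.
by rewrite -/w; lra.
Qed.

End confinement.

(** * Convergence in the mixed topology *)

Section cvge.
Context {R : realType} {T : Type} (F : set_system T) {FF : Filter F}.

Lemma cvge0P (u : T -> \bar R) : (forall t, (0 <= u t)%E) ->
  (u @ F --> 0%E) <-> forall e : R, 0 < e -> \forall t \near F, (u t <= e%:E)%E.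
Proof.
move=> u0; split=> [uF e e0|H U].
  have : nbhs (0%E : \bar R) [set x | (x <= e%:E)%E].
    by exists e => //= r /=; rewrite sub0r normrN lee_fin => /ltW/(le_trans (ler_norm r)).
  by move=> /uF.
move=> [e /= e0 He]; have := H (e / 2) (divr_gt0 e0 (ltr0Sn R 1)).
apply: filterS => t; rewrite /=; have := u0 t; case: (u t) => [r||]//=.
rewrite !lee_fin => r0 re; apply: He => /=; rewrite sub0r normrN ger0_norm//.
by rewrite (le_lt_trans re)// ltr_pdivrMr// ltr_pMr// ltr1n.
Qed.

End cvge.

Section mixed.
Context {R : realType} {d : nat}.
Local Notation Rd := ('rV[R]_d).
Implicit Types (f : Rd -> R) (K : set Rd).

Lemma sup_norm_ge0 K f : (0 <= sup_norm K f)%E.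
Proof. by apply: ereal_sup_ubound; left. Qed.

Lemma sup_norm_ge K f x : K x -> (`|f x|%:E <= sup_norm K f)%E.
Proof. by move=> Kx; apply: ereal_sup_ubound; right; exists x. Qed.

Lemma sup_norm_leP K f (c : R) : 0 <= c ->
  (sup_norm K f <= c%:E)%E <-> forall x, K x -> `|f x| <= c.
Proof.
move=> c0; split=> [H x Kx|H].
  by rewrite -lee_fin (le_trans _ H)// sup_norm_ge.
by apply/ereal_supP => _ [->|[x Kx <-]]; rewrite lee_fin// H.
Qed.

Lemma lty_bound (x : \bar R) : (x < +oo)%E -> exists2 B : R, 0 <= B & (x <= B%:E)%E.
Proof.
case: x => [r _||]//; last by exists 0 => //; rewrite leNye.
by exists `|r| => //; rewrite lee_fin ler_norm.
Qed.

Lemma CbP f : Cb f <-> continuous f /\ exists B : R, forall x, `|f x| <= B.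
Proof.
split=> -[fc fB]; split=> //.
  have [B B0 HB] := lty_bound fB; exists B => x.
  by apply: (sup_norm_leP setT f B0).1.
have [B HB] := fB; apply: (@le_lt_trans _ _ `|B|%:E); last exact: ltry.
by apply/sup_norm_leP => // x _; rewrite (le_trans (HB x))// ler_norm.
Qed.

(** Balls suffice because they absorb compact sets. *)
Lemma mixed_cvgP (f_ : nat -> Rd -> R) f : mixed_cvg f_ f <->
  [/\ forall n, Cb (f_ n), Cb f,
      exists B : R, forall n x, `|f_ n x| <= B &
      forall r e : R, 0 < e ->
        \forall n \near \oo, forall x, enorm x <= r -> `|f_ n x - f x| <= e].
Proof.
split=> -[cf_ cf B H]; split=> //.
- have [B' B0 HB] := lty_bound B; exists B' => n x.
  apply: (sup_norm_leP setT (f_ n) B0).1 => //; apply: le_trans HB.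
  by apply: ereal_sup_ubound; exists n.
- move=> r e e0.
  have /cvge0P/(_ e e0) := H _ (@compact_enorm_ball R d r).
  move=> /(_ (fun=> sup_norm_ge0 _ _)); apply: filterS => n /= Hn x xr.
  exact: (sup_norm_leP _ _ (ltW e0)).1 Hn x xr.
- have [B' HB] := B; apply: (@le_lt_trans _ _ `|B'|%:E); last exact: ltry.
  apply/ereal_supP => _ [n _ <-]; apply/sup_norm_leP => // x _.
  by rewrite (le_trans (HB n x))// ler_norm.
- move=> K /compact_enorm_bounded[r r0 Kr].
  apply/cvge0P => [n|e e0]; first exact: sup_norm_ge0.
  apply: filterS (H r e e0) => n Hn; apply/sup_norm_leP; first exact: ltW.
  by move=> x Kx; apply: Hn; exact: Kr.
Qed.

Lemma mixed_cvg_unique (f_ : nat -> Rd -> R) f g :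
  mixed_cvg f_ f -> mixed_cvg f_ g -> f = g.
Proof.
move=> /mixed_cvgP[_ _ _ Hf] /mixed_cvgP[_ _ _ Hg]; apply/funext => x.
apply/eqP; rewrite -subr_eq0 -normr_le0; apply/ler_addgt0Pr => e e0; rewrite add0r.
have e20 : 0 < e / 2 by rewrite divr_gt0.
have [n [/(_ x (lexx _)) h1 /(_ x (lexx _)) h2]] :
    exists n, (forall y, enorm y <= enorm x -> `|f_ n y - f y| <= e / 2) /\
              (forall y, enorm y <= enorm x -> `|f_ n y - g y| <= e / 2).
  have /(_ _)/filter_ex := filterI (Hf (enorm x) _ e20) (Hg (enorm x) _ e20).
  exact.
rewrite -(subrKA (f_ n x)) (le_trans (ler_normD _ _))// distrC.
by lra.
Qed.

Lemma generatorP (S : R -> (Rd -> R) -> Rd -> R) f g :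
  generator_lim S f g -> generator S f = g.
Proof.
move=> Hg; rewrite /generator; case: xgetP => [h _ Hh|]; last by move=> /(_ g).
have t0 n : (0 : R) < n.+1%:R^-1 by rewrite invr_gt0.
exact: mixed_cvg_unique (Hh _ t0 cvg_harmonic) (Hg _ t0 cvg_harmonic).
Qed.

End mixed.

Section ref_semigroup_bound.
Context {R : realType} {d : nat} {A : Type}.
Local Notation Rd := ('rV[R]_d).
Local Notation E := (borelRd R d).
Context (p : R) (mu : A -> R -> probability E R) (psi : A -> R -> Rd -> Rd).
Hypothesis p_gt0 : 0 < p.
Hypothesis mu_moment : forall (a : A) (t : R), 0 <= t -> finite_moment p (mu a t).
Hypothesis chapman_kolmogorov : forall (a : A) (s t : R) (f : Rd -> R) (x : Rd),
  0 <= s -> 0 <= t -> Cb f ->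
  \int[mu a (s + t)]_y f (psi a (s + t) x + (y : Rd)) =
  \int[mu a t]_yt \int[mu a s]_ys
    f (psi a s (psi a t x + (yt : Rd)) + (ys : Rd)).
Hypothesis psi0 : forall (a : A) (x : Rd), psi a 0 x = x.
Hypothesis mu0 : forall (a : A) (U : set E), measurable U ->
  mu a 0 U = \d_(0 : E) U.
Variables c C : R.
Hypothesis C_gt0 : 0 < C.
Hypothesis psi_growth : forall (a : A) (t : R) (x : Rd), 0 < t ->
  enorm (psi a t x - x) <= t * C * (1 + enorm x).
Hypothesis psi_lip : forall (a : A) (t : R) (x y : Rd), 0 <= t ->
  enorm (psi a t x - psi a t y) <= expR (c * t) * enorm (x - y).
Local Notation T := (ref_semigroup mu psi).

Lemma blip_Cb M L (u : Rd -> R) : blip M L u -> Cb u.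
Proof.
by move=> [uM uL]; apply/CbP; split; [exact: elip_continuous uL|exists M].
Qed.

Lemma ref_semigroup_blip M L a t (u : Rd -> R) : 0 <= t -> 0 <= L -> blip M L u ->
  blip M (L * expR (c * t)) (T a t u).
Proof.
move=> t0 L0 uML; split; first by move=> x; exact: blip_Rintegral_bound uML.
apply: elip_of_le => x y; apply: (le_trans (blip_Rintegral_shift (mu a t) _ (psi a t y) uML)).
by rewrite lerD2l -mulrA ler_wpM2l// psi_lip.
Qed.

Lemma Rintegral_mu0 a (u : E -> R) : measurable_fun setT u ->
  \int[mu a 0]_y u y = u 0.
Proof.
move=> mu_; rewrite /Rintegral.
rewrite (eq_measure_integral (\d_(0 : E))); last by move=> U mU _; exact: mu0.
rewrite integral_dirac//; last exact/measurable_EFinP.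
by rewrite diracT mul1e.
Qed.

Lemma ref_semigroup0 M L a (u : Rd -> R) x : blip M L u -> T a 0 u x = u x.
Proof.
move=> uML; rewrite /ref_semigroup (Rintegral_mu0 _ (blip_measurable _ uML)).
by rewrite psi0 addr0.
Qed.

Lemma moment_mu0 a : \int[mu a 0]_y enorm (y : Rd) `^ p = 0.
Proof.
rewrite (Rintegral_mu0 _ (moment_measurable p)) enorm0 powR0//.
by rewrite gt_eqF.
Qed.

Lemma ref_semigroupD M L a s t (u : Rd -> R) x : 0 <= s -> 0 <= t -> blip M L u ->
  T a (s + t) u x = T a t (T a s u) x.
Proof. by move=> s0 t0 /blip_Cb uC; rewrite /ref_semigroup chapman_kolmogorov. Qed.

(** Telescoping over [n] steps of length [t / n]: each increment is the
    average of [T (t/n) f - f] under a law that keeps most of its mass in a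
    fixed ball, where the difference quotient is close to the generator. *)
Lemma ref_semigroup_bound (f Lf : Rd -> R) M L a C0 t : 0 <= L -> blip M L f ->
  generator_lim (T a) f Lf -> (forall x, `|Lf x| <= C0) ->
  0 < t -> (forall s, 0 <= s <= t -> \int[mu a s]_y enorm (y : Rd) `^ p <= 1) ->
  forall x, `|T a t f x - f x| <= C0 * t.
Proof.
move=> L0 fML gen LfC t0 mom x.
have hpos n : 0 < t / n.+1%:R by rewrite divr_gt0.
have hcvg : (fun n => t / n.+1%:R) @ \oo --> (0 : R).
  by rewrite -(mulr0 t); apply: cvgMr; exact: cvg_harmonic.
have /mixed_cvgP[_ _ [B HB] Hloc] := gen _ hpos hcvg.
pose R1 := enorm x + t * C * (1 + enorm x).
have psiR1 s : 0 <= s <= t -> enorm (psi a s x) <= R1.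
  move=> /andP[]; rewrite le_eqVlt => /predU1P[<- _|s0 st].
    rewrite psi0 lerDl; rewrite !mulr_ge0 ?addr_ge0 ?enorm_ge0// ltW//.
  apply: (le_trans (enorm_le_dist _ x)); rewrite lerD2l.
  apply: (le_trans (psi_growth a x s0)); rewrite -!mulrA ler_wpM2r//.
  by rewrite !mulr_ge0 ?addr_ge0 ?enorm_ge0// ltW.
have B0 : 0 <= B by apply: le_trans (HB 0%N x).
have C00 : 0 <= C0 by apply: le_trans (LfC x).
suff key (e M' : R) : 0 < e -> 0 < M' ->
    `|T a t f x - f x| <= (C0 + e + B / M' `^ p) * t.
  apply/ler_addgt0Pr => e e0.
  pose e1 := e / (2 * t).
  have e10 : 0 < e1 by rewrite divr_gt0// mulr_gt0.
  (* the mass outside the ball then costs at most [e1] *)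
  pose M' := ((B + 1) / e1) `^ p^-1.
  have M'0 : 0 < M' by rewrite powR_gt0// divr_gt0// ltr_wpDl.
  apply: (le_trans (key e1 M' e10 M'0)).
  have -> : M' `^ p = (B + 1) / e1.
    by rewrite -powRrM mulVf ?gt_eqF// powRr1// divr_ge0 ?addr_ge0// ltW.
  have : B / ((B + 1) / e1) <= e1.
    rewrite invf_div mulrA ler_pdivrMr ?ltr_wpDl// mulrC ler_wpM2l ?(ltW e10)//.
    by rewrite lerDl.
  have : e1 * t = e / 2 by rewrite /e1; field; rewrite gt_eqF.
  by nra.
move=> e0 M'0.
have [n Hn] := filter_ex (Hloc (R1 + M') e e0).
pose h := t / n.+1%:R.
have h0 : 0 < h by exact: hpos.
pose u := T a h f.
have uB : blip M (L * expR (c * h)) u by apply: ref_semigroup_blip => //; exact: ltW.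
have M'p : 0 < M' `^ p by exact: powR_gt0.
have step s : 0 <= s <= t ->
    `|T a (h + s) f x - T a s f x| <= (C0 + e + B / M' `^ p) * h.
  move=> st; have s0 : 0 <= s by case/andP: st.
  rewrite (ref_semigroupD a x (ltW h0) s0 fML) -/u /ref_semigroup.
  have Iu := blip_integrable (mu a s) (psi a s x) uB.
  have If := blip_integrable (mu a s) (psi a s x) fML.
  rewrite -RintegralB//.
  have Id : (mu a s).-integrable setT (EFin \o (fun y : E =>
      u (psi a s x + (y : Rd)) - f (psi a s x + (y : Rd)))).
    by have := integrableB measurableT Iu If.
  have Im := moment_integrable (mu_moment a s0).
  apply: (le_trans (le_normr_Rintegral _ _)) => //.
  apply: (@le_trans _ _ (\int[mu a s]_y
     (B / M' `^ p * h * enorm (y : Rd) `^ p + 0 * enorm (y : Rd) `^ p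
       + (C0 + e) * h))).
    apply: le_Rintegral => //.
    - exact: (integrable_norm Id).
    - exact: integrable_affine.
    move=> y _; rewrite mul0r addr0; set z := psi a s x + (y : Rd).
    have hE : u z - f z = h * ((u z - f z) / h) by rewrite mulrC divfK ?gt_eqF.
    rewrite hE normrM (ger0_norm (ltW h0)).
    have [zle|zgt] := leP (enorm z) (R1 + M').
      have : `|(u z - f z) / h| <= C0 + e.
        have := Hn z zle; rewrite -/h -/u => Hz.
        rewrite -[(u z - f z) / h](subrK (Lf z)).
        by rewrite (le_trans (ler_normD _ _))// addrC lerD.
      move=> Hz; apply: (@le_trans _ _ ((C0 + e) * h)).
        by rewrite mulrC ler_wpM2r// ltW.
      by rewrite lerDr !mulr_ge0 ?invr_ge0 ?powR_ge0// ltW.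
    have My : M' <= enorm (y : Rd).
      have := enormD (psi a s x) (y : Rd); have := psiR1 s st; rewrite -/z.
      by lra.
    have : 1 <= (M' `^ p)^-1 * enorm (y : Rd) `^ p.
      rewrite ler_pdivlMl// mulr1 ge0_ler_powR ?nnegrE ?enorm_ge0// ltW//.
    move=> My1; have := HB n z; rewrite -/h -/u => Hz.
    apply: (@le_trans _ _ (h * B)); first by rewrite ler_wpM2l// ltW.
    apply: (@le_trans _ _ (h * B * ((M' `^ p)^-1 * enorm (y : Rd) `^ p))).
      by rewrite ler_peMr// mulr_ge0// ltW.
    rewrite [leLHS](_ : _ = B / M' `^ p * h * enorm (y : Rd) `^ p); last by ring.
    by rewrite lerDl mulr_ge0 ?addr_ge0// ltW.
  rewrite Rintegral_affine// mul0r addr0.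
  rewrite [leRHS](_ : _ = B / M' `^ p * h * 1 + (C0 + e) * h); last by ring.
  rewrite lerD2r ler_wpM2l ?mom// !mulr_ge0 ?invr_ge0 ?powR_ge0//.
  exact: ltW.
have tel k : (k <= n.+1)%N ->
    `|T a (k%:R * h) f x - f x| <= (C0 + e + B / M' `^ p) * (k%:R * h).
  elim: k => [_|k IH kn]; first by rewrite mul0r (ref_semigroup0 a x fML) subrr normr0 mulr0.
  have kh : k.+1%:R * h = h + k%:R * h by rewrite -natr1 mulrDl mul1r addrC.
  rewrite kh -(subrKA (T a (k%:R * h) f x)) (le_trans (ler_normD _ _))//.
  rewrite mulrDr lerD//; last by apply: IH; exact: ltnW.
  apply: step; rewrite mulr_ge0// ?(ltW h0)//=.
  by rewrite /h mulrCA ler_piMr ?(ltW t0)// ler_pdivrMr// mul1r ler_nat ltnW.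
have := tel n.+1 (leqnn _).
by rewrite /h mulrCA divff ?mulr1 ?pnatr_eq0.
Qed.

End ref_semigroup_bound.

(** * First order expansion over a Wasserstein ball *)

Section powR_bounds.
Context {R : realType}.
Implicit Types (p k r eta rho : R).

Lemma powR_ratio_ge1 p rho r : 0 < p -> 0 < rho -> rho <= r -> 1 <= r `^ p / rho `^ p.
Proof.
move=> p0 rho0 rhor; rewrite ler_pdivlMr ?powR_gt0// mul1r.
by rewrite ge0_ler_powR ?nnegrE// ?ltW// (lt_le_trans rho0).
Qed.

(** Superlinear growth of the [p]-th power: up to a constant, a distance is
    an arbitrarily small multiple of its [p]-th power. *)
Lemma powR_superlinear p k eta r : 1 < p -> 0 < k -> 0 < eta -> 0 <= r ->
  r <= k * (eta * (r `^ p / k `^ p) + eta `^ (- (p - 1)^-1)).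
Proof.
move=> p1 k0 eta0 r0; set D := eta `^ _.
have D0 : 0 < D by exact: powR_gt0.
have q0 : 0 < p - 1 by rewrite subr_gt0.
have kp : 0 < k `^ p by exact: powR_gt0.
have [rD|Dr] := leP r (k * D).
  apply: (le_trans rD); rewrite ler_pM2l// lerDr.
  by rewrite !mulr_ge0 ?invr_ge0 ?powR_ge0// ltW.
have rp : 0 < r by apply: le_lt_trans Dr; rewrite mulr_ge0// ltW.
have split_ s : 0 < s -> s `^ p = s `^ (p - 1) * s.
  move=> s0; have := @powRD _ s (p - 1) 1; rewrite subrK (gt_eqF s0) implybT.
  by move=> /(_ isT) ->; rewrite powRr1// ltW.
have : (k * D) `^ (p - 1) <= r `^ (p - 1).
  by rewrite ge0_ler_powR ?nnegrE ?ltW// mulr_gt0.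
rewrite (powRM _ (ltW k0) (ltW D0)) {1}/D -powRrM mulNr mulVf ?gt_eqF//.
rewrite (powR_inv1 (ltW eta0)) => H.
have kq : 0 < k `^ (p - 1) by exact: powR_gt0.
have H2 : k `^ (p - 1) <= eta * r `^ (p - 1) by rewrite mulrC -ler_pdivrMr.
apply: (@le_trans _ _ (k * (eta * (r `^ p / k `^ p)))); last first.
  by rewrite ler_pM2l// lerDl ltW.
rewrite !split_// invfM.
have -> : k * (eta * (r `^ (p - 1) * r * ((k `^ (p - 1))^-1 * k^-1))) =
  r * (eta * r `^ (p - 1) / k `^ (p - 1)).
  by field; rewrite !gt_eqF.
by rewrite ler_peMr ?(ltW rp)// ler_pdivlMr// mul1r.
Qed.

End powR_bounds.

Section local_expansion.
Context {R : realType} {d : nat} {A : Type}.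
Local Notation Rd := ('rV[R]_d).
Local Notation E := (borelRd R d).
Context (p m : R) (mu : A -> R -> probability E R) (psi : A -> R -> Rd -> Rd).
Hypotheses (p_gt1 : 1 < p) (m_ge0 : 0 <= m).
Hypothesis mu_moment : forall (a : A) (t : R), 0 <= t -> finite_moment p (mu a t).
Hypothesis moment_small : forall e : R, 0 < e -> exists2 t0 : R, 0 < t0 &
  forall (a : A) (t : R), 0 < t <= t0 -> \int[mu a t]_y enorm (y : Rd) `^ p <= e.
Variable C : R.
Hypothesis C_gt0 : 0 < C.
Hypothesis psi_growth : forall (a : A) (t : R) (x : Rd), 0 < t ->
  enorm (psi a t x - x) <= t * C * (1 + enorm x).
Variables (f : Rd -> R) (M L : R).
Hypotheses (fM : forall x, `|f x| <= M) (df : forall x, differentiable f x)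
  (cgrad : continuous (grad f)) (L_gt0 : 0 < L)
  (gradL : forall x, enorm (grad f x) <= L).
Local Notation T := (ref_semigroup mu psi).

Let p_gt0 : 0 < p := lt_trans ltr01 p_gt1.

Let fML : blip M L f := conj fM (elip_of_grad df gradL).

Lemma flow_small (r rho : R) : 0 < rho -> exists2 t0 : R, 0 < t0 &
  forall (a : A) (t : R) (x : Rd), 0 < t <= t0 -> enorm x <= r ->
  enorm (psi a t x - x) <= rho.
Proof.
move=> rho0; pose D := C * (1 + `|r|).
have D0 : 0 < D by rewrite mulr_gt0// ltr_pwDl.
exists (rho / D); first exact: divr_gt0.
move=> a t x /andP[t0 tle] xr; apply: (le_trans (psi_growth a x t0)).
apply: (@le_trans _ _ (t * D)); last by rewrite -ler_pdivlMr.
rewrite /D mulrA ler_pM2l ?mulr_gt0// lerD2l.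
exact: (le_trans xr (ler_norm r)).
Qed.

(** On the bad event that [y] or [z - y] is large only the Lipschitz bound is
    available; this event is paid for by moments, which are small. *)
Lemma upper_pointwise (x w y z : Rd) (rho e1 k eta D : R) :
  0 < rho -> 0 < k -> 0 < eta -> 0 <= e1 ->
  (forall v, enorm (v - x) <= 3 * rho -> enorm (grad f v - grad f x) <= e1) ->
  enorm (w - x) <= rho -> D = eta `^ (- (p - 1)^-1) ->
  f (w + z) <= f (w + y) + L * k * D / rho `^ p * enorm y `^ p
    + (enorm (grad f x) + e1) * k * (1 - p^-1)
    + ((enorm (grad f x) + e1) * k / p / k `^ p + L * k * eta / k `^ p
       + L * k * D / rho `^ p) * enorm (y - z) `^ p.
Proof.
move=> rho0 k0 eta0 e10 Hgrad wx DE.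
have D0 : 0 < D by rewrite DE powR_gt0.
set G := enorm (grad f x) + e1; set s := enorm (y - z).
have G0 : 0 <= G by rewrite addr_ge0 ?enorm_ge0.
have s0 : 0 <= s by exact: enorm_ge0.
have kp : 0 < k `^ p by exact: powR_gt0.
have rp : 0 < rho `^ p by exact: powR_gt0.
have tang := ler_wpM2l G0 (tangent_powR p_gt1 k0 s0).
have Y0 : 0 <= enorm y `^ p / rho `^ p by rewrite divr_ge0// ?powR_ge0// ltW.
have S0 : 0 <= s `^ p / rho `^ p by rewrite divr_ge0// ?powR_ge0// ltW.
have K0 : 0 <= s `^ p / k `^ p by rewrite divr_ge0// ?powR_ge0// ltW.
suff H : f (w + z) - f (w + y) <= G * s
    + L * k * (eta * (s `^ p / k `^ p) + D * (enorm y `^ p / rho `^ p + s `^ p / rho `^ p)).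
  rewrite [leRHS](_ : _ = f (w + y) + G * (k * (1 - p^-1) + k / p / k `^ p * s `^ p)
    + L * k * (eta * (s `^ p / k `^ p)
      + D * (enorm y `^ p / rho `^ p + s `^ p / rho `^ p))); last by ring.
  by lra.
have err0 : 0 <= L * k * (eta * (s `^ p / k `^ p)
    + D * (enorm y `^ p / rho `^ p + s `^ p / rho `^ p)).
  apply: mulr_ge0; first exact: mulr_ge0 (ltW L_gt0) (ltW k0).
  apply: addr_ge0; first exact: mulr_ge0 (ltW eta0) K0.
  exact: mulr_ge0 (ltW D0) (addr_ge0 Y0 S0).
have [/andP[yrho srho]|bad] := boolP ((enorm y <= rho) && (s <= rho)).
  apply: (@le_trans _ _ (G * s)); last by rewrite lerDl.
  have [c /andP[c0 c1]] := mean_value (w + y) (z - y) df.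
  rewrite (_ : w + y + (z - y) = w + z); last by rewrite addrACA subrr addr0.
  move=> ->; apply: (le_trans (dot_le _ _)).
  rewrite (enorm_distC z y) -/s ler_wpM2r//.
  apply: (le_trans (enorm_le_dist _ (grad f x))); rewrite /G lerD2l.
  apply: Hgrad.
  have -> : w + y + c *: (z - y) - x = (w - x) + (y + c *: (z - y)).
    by rewrite -(addrA w) addrAC.
  apply: (le_trans (enormD _ _)); have := enormD y (c *: (z - y)).
  have : enorm (c *: (z - y)) <= rho.
    rewrite enormZ ger0_norm// (enorm_distC z y) -/s.
    by apply: le_trans srho; rewrite ler_piMl.
  by lra.
have fs : f (w + z) - f (w + y) <= L * s.
  have [_ /(_ (w + z) (w + y))] := fML; rewrite ler_norml => /andP[_].
  by rewrite opprD addrACA subrr add0r (enorm_distC z y).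
have Gs : 0 <= G * s by rewrite mulr_ge0.
apply: (le_trans fs); have := powR_superlinear p_gt1 k0 eta0 s0; rewrite -DE => H.
have bad1 : 1 <= enorm y `^ p / rho `^ p + s `^ p / rho `^ p.
  move: bad; rewrite negb_and -!ltNge => /orP[/ltW|/ltW] /(powR_ratio_ge1 p_gt0 rho0).
    by move=> /le_trans; apply; rewrite lerDl.
  by move=> /le_trans; apply; rewrite lerDr.
apply: (@le_trans _ _ (L * (k * (eta * (s `^ p / k `^ p) + D)))).
  by rewrite ler_pM2l.
rewrite mulrA -[leLHS]add0r; apply: lerD => //.
apply: ler_wpM2l; first exact: mulr_ge0 (ltW L_gt0) (ltW k0).
by rewrite lerD2l ler_peMr// ltW.
Qed.

(** The radius in the Wasserstein ball is enlarged to [h (m + de)], so that it is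
    positive even for [m = 0]; afterwards all the small parameters are chosen
    so that the errors add up to [h e]. *)
Lemma upper_expansion (r e : R) : 0 < e -> exists2 h0 : R, 0 < h0 &
  forall (x : Rd) (a : A) (h : R) (nu : probability E R),
  enorm x <= r -> 0 < h <= h0 -> wball p m mu a h nu ->
  \int[nu]_z f (psi a h x + (z : Rd)) <=
    T a h f x + h * (m * enorm (grad f x) + e).
Proof.
move=> e0; have m1 : 0 < m + 1 by rewrite ltr_wpDl.
pose s := e / (2 * (m + 1)); have s0 : 0 < s by rewrite divr_gt0// mulr_gt0.
pose e1 := s / 3; have e10 : 0 < e1 by rewrite divr_gt0.
pose eta := e1 / L; have eta0 : 0 < eta by rewrite divr_gt0.
pose D := eta `^ (- (p - 1)^-1); have D0 : 0 < D by exact: powR_gt0.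
pose de := Num.min 1 (e / (2 * L)).
have de0 : 0 < de by rewrite lt_min ltr01 divr_gt0// mulr_gt0.
have de1 : de <= 1 by rewrite ge_min lexx.
have deL : de * L <= e / 2.
  apply: (@le_trans _ _ (e / (2 * L) * L)).
    by rewrite ler_wpM2r ?(ltW L_gt0)// ge_min lexx orbT.
  by rewrite le_eqVlt; apply/orP; left; apply/eqP; field; rewrite gt_eqF.
have [rho3 rho30 Hgrad] := unif_continuous_ball r cgrad e10.
pose rho := rho3 / 3; have rho0 : 0 < rho by rewrite divr_gt0.
have rp : 0 < rho `^ p by exact: powR_gt0.
(* the moment and [k `^ p] will be at most [om], each at the cost [k * e1 / 2] *)
pose om := e1 * rho `^ p / (2 * L * D).
have om0 : 0 < om by apply: divr_gt0; rewrite ?(mulr_gt0 e10)// !mulr_gt0.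
have [t1 t10 Ht1] := moment_small om0.
have [t2 t20 Ht2] := flow_small r rho0.
pose t3 := om `^ p^-1 / (m + 1).
have t30 : 0 < t3 by rewrite divr_gt0// powR_gt0.
exists (Num.min t1 (Num.min t2 t3)); first by rewrite !lt_min t10 t20.
move=> x a h nu xr /andP[h0]; rewrite !le_min => /and3P[ht1 ht2 ht3] [_ W].
pose k := h * (m + de); have k0 : 0 < k by rewrite mulr_gt0// ltr_wpDl.
have kle : k `^ p <= om.
  have -> : om = (om `^ p^-1) `^ p by rewrite -powRrM mulVf ?gt_eqF// powRr1// ltW.
  rewrite ge0_ler_powR ?nnegrE ?(ltW p_gt0) ?powR_ge0 ?(ltW k0)//.
  apply: (@le_trans _ _ (h * (m + 1))); first by rewrite ler_pM2l// lerD2l.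
  by rewrite -ler_pdivlMr.
have kp : 0 < k `^ p by exact: powR_gt0.
have W1 : (wasserstein p (mu a h) nu <= k%:E)%E.
  by apply: (le_trans W); rewrite lee_fin ler_pM2l// lerDl ltW.
have Hg v : enorm (v - x) <= 3 * rho -> enorm (grad f v - grad f x) <= e1.
  by move=> vx; apply: Hgrad => //; apply: (le_trans vx); rewrite /rho; lra.
have wx : enorm (psi a h x - x) <= rho by apply: Ht2; rewrite ?h0.
pose c0 := L * k * D / rho `^ p.
have c00 : 0 <= c0.
  exact: divr_ge0 (mulr_ge0 (mulr_ge0 (ltW L_gt0) (ltW k0)) (ltW D0)) (ltW rp).
have G0 : 0 <= enorm (grad f x) + e1 by rewrite addr_ge0 ?enorm_ge0// ltW.
have If := blip_integrable (mu a h) (psi a h x) fML.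
have Im := moment_integrable (mu_moment a (ltW h0)).
pose v (y : E) := 1 * f (psi a h x + (y : Rd)) + c0 * enorm (y : Rd) `^ p + 0.
have Iv : (mu a h).-integrable setT (EFin \o v) by exact: integrable_affine.
pose be := (enorm (grad f x) + e1) * k / p / k `^ p + L * k * eta / k `^ p + c0.
have be0 : 0 <= be.
  apply: addr_ge0 => //; apply: addr_ge0.
    exact: divr_ge0 (divr_ge0 (mulr_ge0 G0 (ltW k0)) (ltW p_gt0)) (ltW kp).
  exact: divr_ge0 (mulr_ge0 (mulr_ge0 (ltW L_gt0) (ltW k0)) (ltW eta0)) (ltW kp).
have mv : measurable_fun setT v by apply/measurable_EFinP; have /integrableP[] := Iv.
have := transport_le (v := v) (al := (enorm (grad f x) + e1) * k * (1 - p^-1))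
  p_gt0 (ltW k0) W1 be0
  (blip_measurable (psi a h x) fML) (blip_integrable nu (psi a h x) fML) mv Iv.
rewrite [X in _ -> _ <= X + _ + _]Rintegral_affine// mul1r addr0 => H.
apply: (le_trans (H _)).
  move=> y z; have := upper_pointwise y z rho0 k0 eta0 (ltW e10) Hg wx (erefl D).
  by rewrite /v mul1r addr0.
have mom := Ht1 a h; rewrite h0 ht1 in mom; have {}mom := mom isT.
rewrite -/(T a h f x) -!addrA lerD2l.
have -> : (enorm (grad f x) + e1) * k * (1 - p^-1) + be * k `^ p =
   k * (enorm (grad f x) + e1 + L * eta) + c0 * k `^ p.
  by rewrite /be; field; rewrite !gt_eqF.
have c0om : c0 * om = k * e1 / 2.
  by rewrite /c0 /om; field; rewrite !gt_eqF.
have Leta : L * eta = e1 by rewrite /eta mulrC divfK// gt_eqF.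
have h1 := ler_wpM2l c00 mom; have h2 := ler_wpM2l c00 kle.
have g0 := enorm_ge0 (grad f x); have gL := gradL x.
rewrite Leta.
apply: (@le_trans _ _ (k * (enorm (grad f x) + s))); first by rewrite /e1 in h1 h2 c0om *; lra.
rewrite /k -mulrA ler_pM2l//.
have ms : (m + 1) * s = e / 2 by rewrite /s; field; rewrite gt_eqF.
by nra.
Qed.

(** A translation of the reference measure attains the upper bound up to an
    error; large [y] are again controlled by the moment. *)
Lemma lower_expansion (r e : R) : 0 < e -> exists2 h0 : R, 0 < h0 &
  forall (x : Rd) (a : A) (h : R),
  enorm x <= r -> 0 < h <= h0 -> exists2 nu, wball p m mu a h nu &
  T a h f x + h * (m * enorm (grad f x) - e) <=
  \int[nu]_z f (psi a h x + (z : Rd)).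
Proof.
move=> e0; have m1 : 0 < m + 1 by rewrite ltr_wpDl.
pose e1 := e / (2 * (m + 1)); have e10 : 0 < e1 by rewrite divr_gt0// mulr_gt0.
have [rho3 rho30 Hgrad] := unif_continuous_ball r cgrad e10.
pose rho := rho3 / 3; have rho0 : 0 < rho by rewrite divr_gt0.
have rp : 0 < rho `^ p by exact: powR_gt0.
pose om := e1 * rho `^ p / (2 * L).
have om0 : 0 < om by apply: divr_gt0; rewrite ?(mulr_gt0 e10)// !mulr_gt0.
have [t1 t10 Ht1] := moment_small om0.
have [t2 t20 Ht2] := flow_small r rho0.
pose t3 := rho / (m + 1).
have t30 : 0 < t3 by rewrite divr_gt0.
exists (Num.min t1 (Num.min t2 t3)); first by rewrite !lt_min t10 t20.
move=> x a h xr /andP[h0]; rewrite !le_min => /and3P[ht1 ht2 ht3].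
have hm0 : 0 <= h * m by rewrite mulr_ge0// ltW.
have hmrho : h * m <= rho.
  apply: (@le_trans _ _ (h * (m + 1))); first by rewrite ler_pM2l// lerDl.
  by rewrite -ler_pdivlMr.
set w := psi a h x.
have wx : enorm (w - x) <= rho by apply: Ht2; rewrite ?h0.
(* the translation of maximal length in the direction of the gradient *)
have [v vle vdot] : exists2 v : Rd, enorm v <= h * m &
    dot (grad f x) v = h * m * enorm (grad f x).
  have [g0|gn0] := eqVneq (enorm (grad f x)) 0.
    exists 0; first by rewrite enorm0.
    by rewrite g0 mulr0 -(scale0r (0 : Rd)) dotZr mul0r.
  have gp : 0 < enorm (grad f x) by rewrite lt_neqAle eq_sym gn0 enorm_ge0.
  exists ((h * m / enorm (grad f x)) *: grad f x).
    by rewrite enormZ ger0_norm ?divfK// divr_ge0// ltW.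
  by rewrite dotZr dotxx expr2 mulrA divfK.
exists (distribution (mu a h) (translate v)).
  by apply: wball_translate => //; exact: ltW.
rewrite (Rintegral_translate _ _ (blip_measurable w fML) (fun y => fM (w + y))).
have mom := Ht1 a h; rewrite h0 ht1 in mom; have {}mom := mom isT.
pose c0 := - (h * m * (2 * L / rho `^ p)).
have If := blip_integrable (mu a h) w fML.
have Im := moment_integrable (mu_moment a (ltW h0)).
have Iv : (mu a h).-integrable setT (EFin \o (fun y : E => f (w + translate v y))).
  apply: (@bounded_integrable _ _ _ _ _ M); last by move=> y; exact: fM.
  exact: (measurableT_comp (blip_measurable w fML) (measurable_translate v)).
apply: (@le_trans _ _ (\int[mu a h]_y (1 * f (w + (y : Rd)) + c0 * enorm (y : Rd) `^ p
   + h * m * (enorm (grad f x) - e1)))).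
  rewrite Rintegral_affine// mul1r -/(T a h f x) -addrA lerD2l.
  have : h * m * (2 * L / rho `^ p) * \int[mu a h]_y enorm (y : Rd) `^ p <= h * m * e1.
    rewrite -[leLHS]mulrA ler_wpM2l//.
    apply: (@le_trans _ _ (2 * L / rho `^ p * om)).
      by rewrite ler_wpM2l// divr_ge0 ?mulr_ge0// ltW.
    by rewrite le_eqVlt; apply/orP; left; apply/eqP; rewrite /om; field; rewrite !gt_eqF.
  rewrite /c0 mulNr => H.
  have me1 : m * e1 <= e / 2.
    have -> : e / 2 = (m + 1) * e1 by rewrite /e1; field; rewrite gt_eqF.
    by rewrite ler_wpM2r ?lerDl// ltW.
  have := ler_wpM2l (ltW h0) me1; lra.
apply: le_Rintegral => //; first exact: integrable_affine.
move=> y _; rewrite mul1r -addrA -lerBrDl /translate [w + _]addrA.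
have [c /andP[c0' c1]] := mean_value (w + (y : Rd)) v df.
move=> ->.
set xi := w + (y : Rd) + c *: v.
have dE : dot (grad f xi) v = h * m * enorm (grad f x) + dot (grad f xi - grad f x) v.
  by rewrite dotDl -vdot -scaleN1r dotZl; ring.
have := normr_dot_le (grad f xi - grad f x) v; rewrite ler_norml => /andP[dge _].
have Y0 : 0 <= enorm (y : Rd) `^ p / rho `^ p by rewrite divr_ge0// ?powR_ge0// ltW.
have c0E : c0 * enorm (y : Rd) `^ p = - (h * m * (2 * L * (enorm (y : Rd) `^ p / rho `^ p))).
  by rewrite /c0; ring.
rewrite dE c0E.
have gle : enorm (grad f xi - grad f x) <= e1 + 2 * L * (enorm (y : Rd) `^ p / rho `^ p).
  have [yrho|rhoy] := leP (enorm (y : Rd)) rho.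
    apply: (@le_trans _ _ e1); last first.
      by rewrite lerDl; exact: mulr_ge0 (mulr_ge0 (ler0n R 2) (ltW L_gt0)) Y0.
    apply: Hgrad => //; rewrite /xi.
    have -> : w + (y : Rd) + c *: v - x = (w - x) + ((y : Rd) + c *: v).
      by rewrite -(addrA w) addrAC.
    apply: (le_trans (enormD _ _)); have := enormD (y : Rd) (c *: v).
    have : enorm (c *: v) <= rho.
      rewrite enormZ ger0_norm//; apply: le_trans hmrho; apply: le_trans vle.
      by rewrite ler_piMl ?enorm_ge0.
    by rewrite /rho in wx yrho *; lra.
  apply: (le_trans (enormB _ _)).
  have := ler_wpM2l (ltW L_gt0) (powR_ratio_ge1 p_gt0 rho0 (ltW rhoy)).
  by have := gradL xi; have := gradL x; lra.
have : enorm (grad f xi - grad f x) * enorm v <=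
   (e1 + 2 * L * (enorm (y : Rd) `^ p / rho `^ p)) * (h * m).
  by rewrite ler_pM ?enorm_ge0.
by lra.
Qed.

End local_expansion.

(** * The generator of the nonlinear semigroup *)

Section nonlinear_generator.
Context {R : realType} {d : nat} {A : Type}.
Local Notation Rd := ('rV[R]_d).
Local Notation E := (borelRd R d).
Context (p m : R) (mu : A -> R -> probability E R) (psi : A -> R -> Rd -> Rd).
Hypotheses (p_gt1 : 1 < p) (m_ge0 : 0 <= m) (A_neq0 : inhabited A).
Hypothesis mu_moment : forall (a : A) (t : R), 0 <= t -> finite_moment p (mu a t).
Hypothesis moment_small : forall e : R, 0 < e -> exists2 t0 : R, 0 < t0 &
  forall (a : A) (t : R), 0 < t <= t0 -> \int[mu a t]_y enorm (y : Rd) `^ p <= e.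
Hypothesis mu_smooth : forall chi : Rd -> R, Ccinfty chi ->
  exists K t0 : R, [/\ 0 <= K, 0 < t0 & forall (a : A) (t : R), 0 < t <= t0 ->
   `|\int[mu a t]_y (chi (y : Rd) - chi 0)| <= K * t].
Variables c C : R.
Hypotheses (C_gt0 : 0 < C).
Hypothesis psi_growth : forall (a : A) (t : R) (x : Rd), 0 < t ->
  enorm (psi a t x - x) <= t * C * (1 + enorm x).
Hypothesis psi_lip : forall (a : A) (t : R) (x y : Rd), 0 <= t ->
  enorm (psi a t x - psi a t y) <= expR (c * t) * enorm (x - y).
Variables (f : Rd -> R) (M L : R).
Hypotheses (fM : forall x, `|f x| <= M) (df : forall x, differentiable f x)
  (cgrad : continuous (grad f)) (L_gt0 : 0 < L)
  (gradL : forall x, enorm (grad f x) <= L).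
Local Notation T := (ref_semigroup mu psi).
Local Notation S := (S_op p m mu psi).
Variables (Lf : A -> Rd -> R) (C0 t1 : R).
Hypothesis LfC0 : forall a x, `|Lf a x| <= C0.
Hypothesis t1_gt0 : 0 < t1.
Hypothesis T_bound : forall (a : A) (t : R) (x : Rd), 0 < t <= t1 ->
  `|T a t f x - f x| <= C0 * t.
Hypothesis T_unif : forall r e : R, 0 < e -> exists2 t0 : R, 0 < t0 &
  forall (a : A) (t : R) (x : Rd), 0 < t <= t0 -> enorm x <= r ->
  `|(T a t f x - f x) / t - Lf a x| <= e.

Let fML : blip M L f := conj fM (elip_of_grad df gradL).
Let L_ge0 : 0 <= L := ltW L_gt0.

Definition inf_gen (x : Rd) : R := inf (range (fun a => Lf a x)).
Local Notation g := (fun x => inf_gen x + m * enorm (grad f x)).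

Lemma C0_ge0 : 0 <= C0.
Proof. by have [a] := A_neq0; apply: le_trans (LfC0 a 0). Qed.

Lemma inf_gen_le a x : inf_gen x <= Lf a x.
Proof.
apply: ge_inf; last by exists a.
by exists (- C0) => _ [b _ <-]; have := LfC0 b x; rewrite ler_norml => /andP[].
Qed.

Lemma le_inf_gen x l : (forall a, l <= Lf a x) -> l <= inf_gen x.
Proof.
move=> H; apply: lb_le_inf; last by move=> _ [a _ <-].
by have [a] := A_neq0; eexists; exists a.
Qed.

Lemma inf_gen_bound x : `|inf_gen x| <= C0.
Proof.
rewrite ler_norml; apply/andP; split.
  by apply: le_inf_gen => a; have := LfC0 a x; rewrite ler_norml => /andP[].
have [a] := A_neq0; apply: (le_trans (inf_gen_le a x)).
by have := LfC0 a x; rewrite ler_norml => /andP[].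
Qed.

(** The difference quotients at a fixed time are Lipschitz uniformly in [a]
    and approximate all the generators at once, so these are equicontinuous
    and their infimum is continuous. *)
Lemma inf_gen_unif_continuous (r e : R) : 0 < e -> exists2 de, 0 < de &
  forall x y, enorm x <= r -> enorm (y - x) <= de -> `|inf_gen y - inf_gen x| <= e.
Proof.
move=> e0; have e30 : 0 < e / 3 by rewrite divr_gt0.
have [t t0 Ht] := T_unif (r + 1) e30.
pose N := (L * expR (c * t) + L) / t.
have N0 : 0 < N by rewrite divr_gt0// addr_gt0// mulr_gt0// expR_gt0.
exists (Num.min 1 (e / 3 / N)).
  by rewrite lt_min ltr01 divr_gt0.
move=> x y xr; rewrite le_min => /andP[yx1 yxN].
have yr : enorm y <= r + 1 by have := enorm_le_dist y x; lra.
have xr1 : enorm x <= r + 1 by lra.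
have tI : 0 < t <= t by rewrite t0 lexx.
have key a u w : enorm u <= r + 1 -> enorm w <= r + 1 ->
    enorm (u - w) <= e / 3 / N -> Lf a u <= Lf a w + e.
  move=> ur wr uw.
  have [_ /(_ u w)] : blip M (L * expR (c * t)) (T a t f).
    by apply: ref_semigroup_blip => //; exact: ltW.
  rewrite ler_norml => /andP[_ Tuw].
  have [_ /(_ u w)] := fML; rewrite ler_norml => /andP[fuw _].
  have := Ht a t u tI ur; rewrite ler_norml => /andP[+ _].
  have := Ht a t w tI wr; rewrite ler_norml => /andP[_].
  have : (T a t f u - f u) / t - (T a t f w - f w) / t <= e / 3.
    rewrite -mulrBl; apply: (@le_trans _ _ (N * enorm (u - w))); last first.
      by rewrite mulrC -ler_pdivlMr.
    by rewrite /N mulrAC ler_pM2r ?invr_gt0//; lra.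
  by lra.
have yx' : enorm (x - y) <= e / 3 / N by rewrite enorm_distC.
rewrite ler_distl; apply/andP; split.
  rewrite lerBlDr -lerBlDr; apply: le_inf_gen => a; rewrite lerBlDr.
  exact: le_trans (inf_gen_le a x) (key a x y xr1 yr yx').
rewrite -lerBlDr; apply: le_inf_gen => a; rewrite lerBlDr.
exact: le_trans (inf_gen_le a y) (key a y x yr xr1 yxN).
Qed.

Lemma g_unif_continuous (r e : R) : 0 < e -> exists2 de, 0 < de &
  forall x y, enorm x <= r -> enorm (y - x) <= de -> `|g y - g x| <= e.
Proof.
move=> e0; have e20 : 0 < e / 2 by rewrite divr_gt0.
have e'0 : 0 < e / 2 / (m + 1) by rewrite divr_gt0// ltr_wpDl.
have [d1 d10 H1] := inf_gen_unif_continuous r e20.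
have [d2 d20 H2] := unif_continuous_ball r cgrad e'0.
exists (Num.min d1 d2); first by rewrite lt_min d10.
move=> x y xr; rewrite le_min => /andP[yx1 yx2].
have h1 := H1 x y xr yx1; have h2 := H2 x y xr yx2.
have h3 : m * (e / 2 / (m + 1)) <= e / 2.
  rewrite mulrA ler_pdivrMr ?ltr_wpDl// mulrC ler_pM2l// lerDl//.
have e1 := enorm_le_dist (grad f y) (grad f x).
have e2 := enorm_le_dist (grad f x) (grad f y).
rewrite enorm_distC in e2.
have h4 : m * `|enorm (grad f y) - enorm (grad f x)| <= e / 2.
  apply: le_trans h3; rewrite ler_wpM2l//; apply: le_trans h2.
  by rewrite ler_norml; lra.
have -> : inf_gen y + m * enorm (grad f y) - (inf_gen x + m * enorm (grad f x)) =
  (inf_gen y - inf_gen x) + m * (enorm (grad f y) - enorm (grad f x)) by ring.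
by apply: (le_trans (ler_normD _ _)); rewrite [X in _ + X]normrM (ger0_norm m_ge0); lra.
Qed.

Lemma g_bound x : `|g x| <= C0 + m * L.
Proof.
apply: (le_trans (ler_normD _ _)); apply: lerD; first exact: inf_gen_bound.
by rewrite ger0_norm ?mulr_ge0 ?enorm_ge0// ler_wpM2l.
Qed.

Lemma g_Cb : Cb g.
Proof.
apply/CbP; split; last by exists (C0 + m * L); exact: g_bound.
move=> x; apply: enorm_le_cvg => e e0.
by have [de de0 H] := g_unif_continuous (enorm x) e0; exists de => // y; apply: H.
Qed.

(** Telescoping along a partition.  The penalty [B * z] accounts for the
    failure of the one-step bound with rate [ka] far from a given point; as
    [z] grows at rate at most [K] in mean, whatever the controls, the total
    loss is quadratic in the length of the partition. *)
Lemma I_chain_lower (z : Rd -> R) (Mz Lz ka B K h0 : R) : blip Mz Lz z ->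
  0 <= B -> 0 <= K ->
  (forall (a : A) (h : R) (y : Rd), 0 < h <= h0 -> exists nu, [/\ wball p m mu a h nu,
    f y + h * (ka - B * z y) <= \int[nu]_w f (psi a h y + (w : Rd)) &
    \int[nu]_w z (psi a h y + (w : Rd)) <= z y + K * h]) ->
  forall (s : seq R) (u : R) y, path <%R u s -> last u s - u <= h0 ->
  f y + (last u s - u) * (ka - B * z y) - B * K * (last u s - u) ^+ 2
    <= I_chain p m mu psi u s f y.
Proof.
move=> zB B0 K0 H; elim=> [|v s IH] u y /=.
  by move=> _ _; rewrite subrr mul0r expr0n/= mulr0 addr0 subr0.
move=> /andP[uv vs] hle; have vl := path_last_ge vs.
have h0' : 0 < v - u by rewrite subr_gt0.
have hh0 : v - u <= h0 by lra.
set h := v - u in h0' hh0 *.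
set l := last v s in vl hle *.
set tau := l - v; have tau0 : 0 <= tau by rewrite subr_ge0.
have -> : l - u = h + tau by rewrite /h /tau; ring.
have uB := I_chain_blip p_gt1 m_ge0 A_neq0 mu_moment psi_lip L_ge0 fML vs.
apply: (I_op_ge A_neq0 (ltW h0') uB) => a.
have hI : 0 < h <= h0 by rewrite h0'.
have [nu [nuB nuf nuz]] := H a h y hI; exists nu => //.
have If := blip_integrable nu (psi a h y) fML.
have Iz := blip_integrable nu (psi a h y) zB.
apply: (@le_trans _ _ (\int[nu]_w (1 * f (psi a h y + (w : Rd))
   + - (tau * B) * z (psi a h y + (w : Rd)) + (tau * ka - B * K * tau ^+ 2)))).
  rewrite Rintegral_affine// mul1r.
  have tB : 0 <= tau * B by rewrite mulr_ge0.
  have h1 := ler_wpM2l tB nuz.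
  have h2 : 0 <= B * K * (h ^+ 2 + h * tau).
    by rewrite !mulr_ge0// addr_ge0 ?sqr_ge0// mulr_ge0// ltW.
  by lra.
apply: le_Rintegral => //.
- exact: integrable_affine.
- exact: blip_integrable uB.
move=> w _; have := IH v (psi a h y + (w : Rd)) vs.
rewrite -/l -/tau => /(_ _)/(le_trans _) -> //; last by rewrite /tau; lra.
by lra.
Qed.

Lemma S_upper (r e : R) : 0 < e -> exists2 h0 : R, 0 < h0 &
  forall (x : Rd) (t : R), enorm x <= r -> 0 < t <= h0 ->
  S t f x <= f x + t * (g x + e).
Proof.
move=> e0; have e30 : 0 < e / 3 by rewrite divr_gt0.
have [h1 h10 H1] := upper_expansion p_gt1 m_ge0 mu_moment moment_small C_gt0
  psi_growth fM df cgrad L_gt0 gradL r e30.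
have [h2 h20 H2] := T_unif r e30.
exists (Num.min h1 h2); first by rewrite lt_min h10.
move=> x t xr /andP[t0]; rewrite le_min => /andP[th1 th2].
have tt : partitions t [:: t] by split=> //=; rewrite t0.
apply: (le_trans (S_op_le p_gt1 m_ge0 A_neq0 mu_moment psi_lip x L_ge0 fML tt)).
rewrite /= subr0.
have [a Ha] : exists a, Lf a x <= inf_gen x + e / 3.
  apply: contrapT => /forallNP H; have : inf_gen x + e / 3 <= inf_gen x.
    by apply: le_inf_gen => a; have /negP := H a; rewrite -ltNge => /ltW.
  by lra.
apply: (I_op_le p_gt1 m_ge0 mu_moment (a := a) (ltW t0) fML) => nu nuB.
have tI1 : 0 < t <= h1 by rewrite t0.
have tI2 : 0 < t <= h2 by rewrite t0.
apply: (le_trans (H1 x a t nu xr tI1 nuB)).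
have := H2 a t x tI2 xr; rewrite ler_norml => /andP[_].
rewrite lerBlDr ler_pdivrMr// => h.
by nra.
Qed.

(** The lower half is [I_chain_lower] without penalty, with the rate [- C0]. *)
Lemma S_bound : exists B h0 : R, 0 < h0 /\
  forall (x : Rd) (t : R), 0 < t <= h0 -> `|S t f x - f x| <= B * t.
Proof.
exists (C0 + L * (m + 1)), t1; split=> // x t tI.
have t0 : 0 < t by case/andP: tI.
have Lm : 0 <= L * (m + 1) by rewrite mulr_ge0// addr_ge0.
rewrite ler_distl; apply/andP; split.
  apply: S_op_ge => // s [sp sl].
  have zB : blip 0 0 (fun _ : Rd => 0 : R).
    by split=> [y|y w]; rewrite ?subrr ?normr0// mul0r.
  have := I_chain_lower (ka := - C0) (h0 := t1) (s := s) (u := 0) zB (lexx 0) (lexx 0) _ x sp.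
  rewrite sl subr0 !mul0r !subr0 => /(_ _ _)/(le_trans _); apply.
  - by rewrite mulrN lerD2l lerN2 mulrC ler_wpM2r ?(ltW t0)// lerDl.
  - move=> a h y hI; have h0 : 0 < h by case/andP: hI.
    exists (distribution (mu a h) (translate 0)); split.
    + by apply: wball_translate => //; rewrite ?enorm0 ?mulr_ge0// ltW.
    + rewrite (Rintegral_translate _ _ (blip_measurable _ fML) (fun w => fM _)).
      have := T_bound a y hI; rewrite ler_distl => /andP[+ _].
      rewrite /ref_semigroup ?mul0r ?subr0 mulrN mulrC => /le_trans; apply.
      rewrite le_eqVlt; apply/orP; left; apply/eqP; apply: eq_Rintegral => w _.
      by rewrite /translate addr0.
    + by rewrite prob_Rintegral_cst ?mul0r ?addr0.
  - by case/andP: tI.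
have [a] := A_neq0.
have tt : partitions t [:: t] by split=> //=; rewrite t0.
apply: (le_trans (S_op_le p_gt1 m_ge0 A_neq0 mu_moment psi_lip x L_ge0 fML tt)).
rewrite /= subr0.
apply: (I_op_le p_gt1 m_ge0 mu_moment (a := a) (ltW t0) fML) => nu [_ W].
have k0 : 0 < t * (m + 1) by rewrite mulr_gt0// ltr_wpDl.
have W1 : (wasserstein p (mu a t) nu <= (t * (m + 1))%:E)%E.
  by apply: (le_trans W); rewrite lee_fin ler_pM2l// lerDl.
have := transport_lip p_gt1 k0 L_ge0 W1 (elip_translate (psi a t x) fML.2)
  (fun w => fM (psi a t x + w)).
move=> /le_trans; apply; have := T_bound a x tI.
rewrite ler_distl => /andP[_]; rewrite /ref_semigroup => h.
by rewrite (mulrDl C0); lra.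
Qed.

(** Near [x0] the expansion holds at rate [ka] because [g] varies little there;
    elsewhere the penalty brings the required rate below [- C0]. *)
Lemma S_lower (r e : R) : 0 < e -> exists2 h0 : R, 0 < h0 &
  forall (x : Rd) (t : R), enorm x <= r -> 0 < t <= h0 ->
  f x + t * (g x - e) <= S t f x.
Proof.
move=> e0; have e40 : 0 < e / 4 by rewrite divr_gt0.
have [de' de'0 Hg] := g_unif_continuous r e40.
pose de := Num.min 1 de'; have de0 : 0 < de by rewrite lt_min ltr01.
have de1 : de <= 1 by rewrite ge_min lexx.
have dede' : de <= de' by rewrite ge_min lexx orbT.
have [K [h1 [K0 h10 Hcap]]] := cap_step p_gt1 m_ge0 C_gt0 psi_growth mu_smooth r de0.
have [h2 h20 Hlow] := lower_expansion p_gt1 m_ge0 mu_moment moment_small C_gt0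
  psi_growth fM df cgrad L_gt0 gradL (r + 1) e40.
have [h3 h30 HT] := T_unif (r + 1) e40.
(* [B * de ^+ 2] outweighs the sum of [C0] and of the bound of [g] *)
pose B := (C0 + m * L + C0) / de ^+ 2.
have de2 : 0 < de ^+ 2 by rewrite exprn_gt0.
have C00 := C0_ge0; have mL0 : 0 <= m * L by rewrite mulr_ge0.
have B0 : 0 <= B by rewrite divr_ge0 ?(ltW de2)// !addr_ge0.
have BK0 : 0 <= B * K by rewrite mulr_ge0.
pose h4 := e / 4 / (B * K + 1).
have h40 : 0 < h4 by rewrite divr_gt0// ltr_wpDl.
pose h0 := Num.min t1 (Num.min h1 (Num.min h2 (Num.min h3 h4))).
have hle h : h <= h0 -> [/\ h <= t1, h <= h1, h <= h2, h <= h3 & h <= h4].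
  by rewrite /h0 !le_min => /and5P[].
exists h0; first by rewrite /h0 !lt_min t1_gt0 h10 h20 h30.
move=> x0 t x0r /andP[t0 th0].
pose z (y : Rd) := cap de (y - x0).
have zB : blip (de ^+ 2) (2 * de) z by apply: cap_blip; exact: ltW.
pose ka := g x0 - 3 * (e / 4).
apply: S_op_ge => // s [sp sl].
have z0 : z x0 = 0 by rewrite /z subrr cap0.
have := I_chain_lower (ka := ka) (h0 := h0) (s := s) (u := 0) zB B0 K0 _ x0 sp.
rewrite sl subr0 z0 mulr0 subr0 => /(_ _ th0)/(le_trans _); apply.
  have [_ _ _ _ th4] := hle t th0.
  have : B * K * t <= e / 4.
    apply: (@le_trans _ _ ((B * K + 1) * h4)).
      by rewrite ler_pM ?lerDl// ltW.
    by rewrite /h4 mulrC divfK// gt_eqF// ltr_wpDl.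
  move=> h; rewrite /ka expr2.
  have := ler_wpM2l (ltW t0) h; lra.
move=> a h y /andP[hp hh0]; have [ht1 hh1 hh2 hh3 _] := hle h hh0.
have hI1 : 0 < h <= h1 by rewrite hp.
have hI2 : 0 < h <= h2 by rewrite hp.
have hI3 : 0 < h <= h3 by rewrite hp.
have hIt : 0 < h <= t1 by rewrite hp.
have [yde|dey] := leP (enorm (y - x0)) de.
  have yr : enorm y <= r + 1 by have := enorm_le_dist y x0; lra.
  have [nu nuB nuf] := Hlow y a h yr hI2; exists nu; split=> //; last first.
    exact: Hcap nuB.
  apply: le_trans nuf.
  have := HT a h y hI3 yr; rewrite ler_norml => /andP[+ _].
  rewrite lerBrDr ler_pdivlMr// => hT.
  have := Hg x0 y x0r (le_trans yde dede'); rewrite ler_norml => /andP[+ _].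
  rewrite lerBrDr => hg.
  have hinf := inf_gen_le a y.
  have : 0 <= B * z y by rewrite mulr_ge0 ?cap_ge0.
  move=> Bz; rewrite /ka.
  have : h * (g x0 - 3 * (e / 4) - B * z y) <=
         h * (Lf a y - e / 4 + (m * enorm (grad f y) - e / 4)).
    by rewrite ler_pM2l//; lra.
  by lra.
(* far from [x0] the reference measure itself, a translation by [0], is used *)
have ball0 : wball p m mu a h (distribution (mu a h) (translate 0)).
  by apply: wball_translate => //; rewrite ?enorm0 ?mulr_ge0// ltW.
exists (distribution (mu a h) (translate 0)); split=> //; last exact: Hcap ball0.
rewrite (Rintegral_translate _ _ (blip_measurable _ fML) (fun w => fM _)).
have := T_bound a y hIt; rewrite ler_distl => /andP[+ _].
rewrite (_ : \int[mu a h]_w f (psi a h y + translate 0 w) = T a h f y); last first.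
  by apply: eq_Rintegral => w _; rewrite /translate addr0.
move=> /(le_trans _); apply.
rewrite /z (cap_out (ltW de0) (ltW dey)) /B divfK ?gt_eqF//.
have := g_bound x0; rewrite ler_norml => /andP[_ gx0].
have : h * (ka - (C0 + m * L + C0)) <= h * (- C0).
  by rewrite ler_pM2l// /ka; lra.
by lra.
Qed.

Lemma S_generator_lim : generator_lim S f g.
Proof.
move=> t_ t_gt0 t_cvg.
have [B [h0 [h00 HB]]] := S_bound.
have M0 : 0 <= M by apply: le_trans (fM 0).
have quotB n x : `|(S (t_ n) f x - f x) / t_ n| <= `|B| + 2 * M / h0.
  have tn := t_gt0 n; rewrite normrM normfV (gtr0_norm tn) ler_pdivrMr//.
  have Mh : 0 <= 2 * M / h0 by rewrite divr_ge0 ?mulr_ge0// ltW.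
  have [th|ht] := leP (t_ n) h0.
    have tI : 0 < t_ n <= h0 by rewrite tn.
    apply: (le_trans (HB x (t_ n) tI)); rewrite ler_wpM2r ?(ltW tn)//.
    by rewrite (le_trans (ler_norm B))// lerDl.
  have [SM _] := S_op_blip p_gt1 m_ge0 A_neq0 mu_moment psi_lip tn L_ge0 fML.
  apply: (le_trans (ler_normB _ _)).
  apply: (@le_trans _ _ (2 * M)); first by have := SM x; have := fM x; lra.
  apply: (@le_trans _ _ (2 * M / h0 * t_ n)); last first.
    by rewrite ler_wpM2r ?(ltW tn)// lerDr.
  rewrite mulrAC ler_pdivlMr//; apply: ler_wpM2l; last exact: ltW.
  exact: mulr_ge0 (ler0n R 2) M0.
apply/mixed_cvgP; split.
- move=> n; apply/CbP; split; last by exists (`|B| + 2 * M / h0).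
  have [_ Slip] := S_op_blip p_gt1 m_ge0 A_neq0 mu_moment psi_lip (t_gt0 n) L_ge0 fML.
  apply: (@elip_continuous _ _ ((L * expR (c * t_ n) + L) / t_ n)) => y z.
  have tn := t_gt0 n.
  rewrite -mulrBl normrM normfV (gtr0_norm tn) mulrAC ler_pM2r ?invr_gt0//.
  have -> : S (t_ n) f y - f y - (S (t_ n) f z - f z) =
    (S (t_ n) f y - S (t_ n) f z) - (f y - f z) by ring.
  rewrite mulrDl; apply: (le_trans (ler_normB _ _)); apply: lerD; first exact: Slip.
  exact: fML.2.
- exact: g_Cb.
- by exists (`|B| + 2 * M / h0).
- move=> r e e0; have [h1 h10 H1] := S_upper r e0; have [h2 h20 H2] := S_lower r e0.
  have hh : 0 < Num.min h1 h2 by rewrite lt_min h10.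
  have Hn : \forall n \near \oo, `|t_ n| <= Num.min h1 h2.
    by move/cvgr0Pnorm_le : t_cvg => /(_ _ hh).
  apply: filterS Hn => n tn x xr.
  have tn0 := t_gt0 n; move: tn; rewrite (gtr0_norm tn0) le_min => /andP[th1 th2].
  have tI1 : 0 < t_ n <= h1 by rewrite tn0.
  have tI2 : 0 < t_ n <= h2 by rewrite tn0.
  have u1 := H1 x _ xr tI1; have u2 := H2 x _ xr tI2.
  rewrite ler_distl; apply/andP; split.
    by rewrite ler_pdivlMr//; lra.
  by rewrite ler_pdivrMr//; lra.
Qed.

End nonlinear_generator.

(** * From extended suprema and limits to explicit bounds *)

Section extraction.
Context {R : realType}.

Lemma near_right0P (P : R -> Prop) : (\forall t \near (0 : R)^'+, P t) ->
  exists2 t0 : R, 0 < t0 & forall t, 0 < t <= t0 -> P t.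
Proof.
move=> [e /= e0 He]; exists (e / 2); first by rewrite divr_gt0.
move=> t /andP[t0 te]; apply: He => //=; rewrite sub0r normrN gtr0_norm//.
by rewrite (le_lt_trans te)// ltr_pdivrMr// ltr_pMr// ltr1n.
Qed.

Lemma ereal_sup_cvg0 (A : Type) (u : R -> A -> \bar R) : inhabited A ->
  (forall t a, (0 <= u t a)%E) ->
  (fun t => ereal_sup (range (u t))) @ (0 : R)^'+ --> 0%E ->
  forall e : R, 0 < e -> exists2 t0 : R, 0 < t0 &
  forall t a, 0 < t <= t0 -> (u t a <= e%:E)%E.
Proof.
move=> [a0] u0 /cvge0P H e e0.
have [|t0 t00 Ht] := near_right0P (H _ e e0).
  by move=> t; apply: le_ereal_sup_tmp; exists (u t a0) => //; exists a0.
exists t0 => // t a /Ht; apply: le_trans.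
by apply: ereal_sup_ubound; exists a.
Qed.

Lemma limf_esup_bound (A : Type) (v : R -> A -> R) :
  (limf_esup (fun t : R => ereal_sup (range (fun a => (v t a)%:E))) (0 : R)^'+ < +oo)%E ->
  exists K t0 : R, [/\ 0 <= K, 0 < t0 & forall t a, 0 < t <= t0 -> v t a <= K].
Proof.
move=> /ereal_inf_lt[_ [V V0 <-]] /lty_bound[K K0 HK].
have [t0 t00 Ht] := near_right0P V0; exists K, t0; split=> // t a /Ht Vt.
rewrite -lee_fin; apply: le_trans HK.
apply: le_ereal_sup_tmp; exists (ereal_sup (range (fun a => (v t a)%:E))).
  by exists t.
by apply: ereal_sup_ubound; exists a.
Qed.

Lemma Ccinfty_bounded {d : nat} (chi : 'rV[R]_d -> R) : Ccinfty chi ->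
  exists B : R, forall x, `|chi x| <= B.
Proof.
move=> [sm cs]; have cc : continuous chi.
  by move=> y; apply: differentiable_continuous; exact: (sm [::] y).
have /compact_bounded[B [_ HB]] :=
  continuous_compact (continuous_subspaceT cc) cs.
exists (`|B| + 1) => x; have [->|chix] := eqVneq (chi x) 0.
  by rewrite normr0 addr_ge0.
apply: (HB (`|B| + 1)); first by rewrite (le_lt_trans (ler_norm B))// ltrDl.
by exists x => //; apply: subset_closure.
Qed.

End extraction.

Theorem theorem2p11 (R : realType) (d : nat) (p m : R) (A : Type)
  (mu : A -> R -> probability (borelRd R d) R)
  (psi : A -> R -> 'rV[R]_d -> 'rV[R]_d)
  (p_gt1 : 1 < p) (m_ge0 : 0 <= m) (A_neq0 : inhabited A)
  (mu_moment : forall (a : A) (t : R), 0 <= t -> finite_moment p (mu a t))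
  (psi_cont : forall (a : A) (t : R), 0 <= t -> continuous (psi a t))
  (chapman_kolmogorov : forall (a : A) (s t : R) (f : 'rV[R]_d -> R) (x : 'rV[R]_d),
     0 <= s -> 0 <= t -> Cb f ->
     \int[mu a (s + t)]_y f (psi a (s + t) x + (y : 'rV[R]_d)) =
     \int[mu a t]_yt \int[mu a s]_ys
       f (psi a s (psi a t x + (yt : 'rV[R]_d)) + (ys : 'rV[R]_d)))
  (psi0 : forall a x, psi a 0 x = x)
  (psi_growth : exists C : R, 0 < C /\
     forall x : 'rV[R]_d, (ereal_sup [set u | exists (a : A) (t : R), (0 < t)%R /\
                  u = (enorm (psi a t x - x) / t)%:E]
                <= (C * (1 + enorm x))%:E)%E)
  (psi_lip : exists c : R, 0 <= c /\
     forall (t : R) (x1 x2 : 'rV[R]_d), 0 <= t ->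
       (ereal_sup (range (fun a => (enorm (psi a t x1 - psi a t x2))%:E))
        <= (expR (c * t) * enorm (x1 - x2))%:E)%E)
  (mu_smooth : forall chi : 'rV[R]_d -> R, Ccinfty chi ->
     (limf_esup (fun t : R => ereal_sup (range (fun a =>
        `| \int[mu a t]_y ((chi (y : 'rV[R]_d) - chi 0) / t) |%:E)))
        (0 : R)^'+ < +oo)%E)
  (mu0 : forall a (U : set (borelRd R d)), measurable U ->
     mu a 0 U = \d_(0 : borelRd R d) U)
  (mu_moment_lim :
     (fun t : R => ereal_sup (range (fun a =>
        (\int[mu a t]_y (enorm (y : 'rV[R]_d) `^ p)%:E)%E)))
     @ (0 : R)^'+ --> 0%E)
  (mu_tail : forall eps : R, 0 < eps -> exists M : R, 0 < M /\
     (ereal_sup [set u | exists (a : A) (t : R), (0 < t)%R /\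
        u = mu a t [set y : borelRd R d | (M < enorm (y : 'rV[R]_d))%R] * (t^-1)%:E]
      < eps%:E)%E)
  (f : 'rV[R]_d -> R)
  (f_dom : forall a, generator_dom (ref_semigroup mu psi a) f)
  (f_Cb1 : Cb1 f)
  (Lf_bounded : (ereal_sup (range (fun a =>
     sup_norm setT (generator (ref_semigroup mu psi a) f))) < +oo)%E)
  (Lf_unif : forall K : set 'rV[R]_d, compact K ->
     (fun t : R => ereal_sup (range (fun a => sup_norm K (fun x =>
        (ref_semigroup mu psi a t f x - f x) / t
        - generator (ref_semigroup mu psi a) f x))))
     @ (0 : R)^'+ --> 0%E) :
  generator_dom (S_op p m mu psi) f /\
  forall x, generator (S_op p m mu psi) f x =
    inf (range (fun a => generator (ref_semigroup mu psi a) f x))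
    + m * enorm (grad f x).
Proof.
have p_gt0 : 0 < p := lt_trans ltr01 p_gt1.
have [C [C_gt0 HC]] := psi_growth.
have growth a t x : 0 < t -> enorm (psi a t x - x) <= t * C * (1 + enorm x).
  move=> t0; rewrite -mulrA mulrC -ler_pdivrMr// -lee_fin.
  by apply: le_trans (HC x); apply: ereal_sup_ubound; exists a, t.
have [c [_ Hc]] := psi_lip.
have lip a t x y : 0 <= t ->
    enorm (psi a t x - psi a t y) <= expR (c * t) * enorm (x - y).
  move=> t0; rewrite -lee_fin; apply: le_trans (Hc t x y t0).
  by apply: ereal_sup_ubound; exists a.
have smooth_bound chi : Ccinfty chi -> exists K t0 : R, [/\ 0 <= K, 0 < t0 &
    forall a t, 0 < t <= t0 ->
    `|\int[mu a t]_y (chi (y : 'rV[R]_d) - chi 0)| <= K * t].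
  move=> chiC; have [K [t0 [K0 t00 HK]]] := limf_esup_bound (mu_smooth chi chiC).
  exists K, t0; split=> // a t tI; have := HK t a tI; have tp : 0 < t by case/andP: tI.
  have chi_int : (mu a t).-integrable setT
      (EFin \o (fun y : borelRd R d => chi (y : 'rV[R]_d) - chi 0)).
    have cc : continuous chi.
      by move=> y; apply: differentiable_continuous; exact: (chiC.1 [::] y).
    have [B HB] := Ccinfty_bounded chiC.
    apply: (@bounded_integrable _ _ _ _ _ (B + B)) => [|y].
      by apply: measurable_funB => //; exact: continuous_borel_measurable.
    by apply: (le_trans (ler_normB _ _)); exact: lerD.
  rewrite RintegralZr// normrM normfV (gtr0_norm tp) ler_pdivrMr//.
have moment_small e : 0 < e -> exists2 t0 : R, 0 < t0 & forall a t, 0 < t <= t0 ->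
    \int[mu a t]_y enorm (y : 'rV[R]_d) `^ p <= e.
  move=> e0; have [|t0 t00 Ht] := ereal_sup_cvg0 A_neq0 _ mu_moment_lim e0.
    by move=> t a; apply: integral_ge0 => y _; rewrite lee_fin powR_ge0.
  exists t0 => // a t tI; rewrite -lee_fin fineK ?Ht//.
  apply: integrable_fin_num => //; apply: moment_integrable; apply: mu_moment.
  by apply: ltW; case/andP: tI.
have [fCb [df [cgrad [L' gradL']]]] := f_Cb1.
have [fc [M fM]] := (CbP f).1 fCb.
pose L := `|L'| + 1; have L_gt0 : 0 < L by rewrite ltr_wpDl.
have gradL x : enorm (grad f x) <= L.
  by rewrite (le_trans (gradL' x))// (le_trans (ler_norm L'))// lerDl.
have fML : blip M L f := conj fM (elip_of_grad df gradL).
pose Lf a := generator (ref_semigroup mu psi a) f.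
have gen a : generator_lim (ref_semigroup mu psi a) f (Lf a).
  by have [_ [g Hg]] := f_dom a; rewrite /Lf (generatorP Hg).
have [C0 C0_ge0 HC0] := lty_bound Lf_bounded.
have LfC0 a x : `|Lf a x| <= C0.
  apply: (sup_norm_leP setT (Lf a) C0_ge0).1 => //; apply: le_trans HC0.
  by apply: ereal_sup_ubound; exists a.
have [t1 t1_gt0 Ht1] := moment_small 1 ltr01.
have T_bound a t x : 0 < t <= t1 -> `|ref_semigroup mu psi a t f x - f x| <= C0 * t.
  move=> /andP[t0 tt1].
  apply: (ref_semigroup_bound p_gt0 mu_moment chapman_kolmogorov psi0 mu0 C_gt0
    growth lip (ltW L_gt0) fML (gen a) (LfC0 a) t0) => s /andP[].
  rewrite le_eqVlt => /predU1P[<- _|s0 st].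
    by rewrite (moment_mu0 p_gt0 mu0) ler01.
  by apply: Ht1; rewrite s0 (le_trans st).
have T_unif r e : 0 < e -> exists2 t0 : R, 0 < t0 & forall a t x,
    0 < t <= t0 -> enorm x <= r ->
    `|(ref_semigroup mu psi a t f x - f x) / t - Lf a x| <= e.
  move=> e0; have [|t0 t00 Ht] :=
    ereal_sup_cvg0 A_neq0 _ (Lf_unif _ (@compact_enorm_ball R d r)) e0.
    by move=> t a; exact: sup_norm_ge0.
  exists t0 => // a t x tI xr.
  exact: (sup_norm_leP _ _ (ltW e0)).1 (Ht t a tI) x xr.
have lim := S_generator_lim p_gt1 m_ge0 A_neq0 mu_moment moment_small smooth_bound
  C_gt0 growth lip fM df cgrad L_gt0 gradL LfC0 t1_gt0 T_bound T_unif.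
split; first by split=> //; eexists; exact: lim.
by move=> x; rewrite (generatorP lim).
Qed.
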